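(* Let $I$ be a non-empty set, let $E$ be a Banach sequence lattice on $I$, and let $(A_i)_{i\in I}$ be Banach algebras. Let $A:=\bigl(\bigoplus_{i\in I}A_i\bigr)_E$ be their $E$-sum. (1) If $A$ is weakly amenable, then each $A_i$ is weakly amenable. (2) If every $A_i$ is commutative and weakly amenable, then $A$ is weakly amenable. (In fact every bounded derivation $A\to A^*$ is zero.) (3) Assume $I$ is infinite and $E=\ell_p(I)$ for some $1<p<\infty$. Let $B$ be a weakly amenable non-commutative Banach algebra, and form the constant family $A_i=B$. Then the algebra $\bigl(\bigoplus_{i\in I}B\bigr)_{\ell_p(I)}$ is not weakly amenable.
   Context: All Banach spaces and algebras are complex. $c_{00}(I)$ denotes the finitely supported complex functions on $I$. Weak amenability. For a Banach algebra $A$, $A^*$ is an $A$-bimodule via $(a\cdot\phi)(x)=\phi(xa)$, $(\phi\cdot a)(x)=\phi(ax)$. A bounded linear map $D\colon A\to A^*$ is a derivation if $D(ab)=a\cdot D(b)+D(a)\cdot b$ for all $a,b\in A$. For $\phi\in A^*$, $\mathrm{ad}_\phi(a):=a\cdot\phi-\phi\cdot a$ is the inner derivation implemented by $\phi$. $A$ is weakly amenable if every bounded derivation $A\to A^*$ is inner. Banach sequence lattice. A Banach sequence lattice on $I$ is a Banach space $E$ of complex-valued functions on $I$ such that (a) $c_{00}(I)\subseteq E\subseteq\ell_\infty(I)$ and $c_{00}(I)$ is dense in $E$; (b) $E$ is solid: if $y\in E$, $x\in\ell_\infty(I)$ and $|x_i|\le|y_i|$ for all $i$, then $x\in E$ and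 $\|x\|_E\le\|y\|_E$; (c) $\|x\|_\infty\le\|x\|_E$ for all $x\in E$. $E$-sum. $\bigl(\bigoplus_{i\in I}A_i\bigr)_E$ is the Banach algebra of all families $a=(a_i)_{i\in I}$, $a_i\in A_i$, with $(\|a_i\|)_{i\in I}\in E$, with norm $\|a\|=\|(\|a_i\|)_{i\in I}\|_E$ and coordinatewise multiplication. *)

(* Defs.v *)
From HB Require Import structures.
From mathcomp Require Import all_boot all_order all_algebra.
From mathcomp Require Import all_classical all_reals all_analysis.
From mathcomp Require Import complex.

Set Implicit Arguments.
Unset Strict Implicit.
Unset Printing Implicit Defensive.

Import Order.TTheory GRing.Theory Num.Theory.
Import numFieldNormedType.Exports.
Import Normc.

Local Open Scope classical_set_scope.
Local Open Scope ring_scope.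
Local Open Scope complex_scope.

(* Banach algebras are not assumed to be unital, so they cannot be built on
   the (unital) ring structures of the library. *)
HB.mixin Record CompleteNormedModule_isBanachAlgebra (K : numFieldType) V
    & CompleteNormedModule K V := {
  bmul : V -> V -> V;
  bmulA : associative bmul;
  bmulDl : left_distributive bmul +%R;
  bmulDr : right_distributive bmul +%R;
  bmulZl : forall (k : K) (x y : V), bmul (k *: x) y = k *: bmul x y;
  bmulZr : forall (k : K) (x y : V), bmul x (k *: y) = k *: bmul x y;
  ler_norm_bmul : forall x y : V, `|bmul x y| <= `|x| * `|y|
}.

#[short(type="banachAlgType")]
HB.structure Definition BanachAlgebra (K : numFieldType) :=
  {V of CompleteNormedModule K V & CompleteNormedModule_isBanachAlgebra K V}.

Section complex_norm.
Context {R : realType}.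

Lemma normcE (z : R[i]) : (normc z)%:C = `|z|.
Proof. by rewrite normc_def; case: z. Qed.

Lemma normc_ge0 (z : R[i]) : 0 <= normc z.
Proof. by case: z => a b; exact: sqrtr_ge0. Qed.

Lemma normRe (V : normedModType R[i]) (x : V) :
  (complex.Re (`|x| : R[i]))%:C = `|x| :> R[i].
Proof. exact: (RRe_real (ger0_real (normr_ge0 x))). Qed.

End complex_norm.

Lemma linear_boundW (K : numFieldType) (V W : normedModType K)
    (f : {linear V -> W}) (M : K) :
  M \is Num.real -> (forall x, `|f x| <= M * `|x|) -> continuous f.
Proof.
move=> Mr fM; apply: bounded_linear_continuous; apply/linear_boundedP.
exists M; split => // r Mlt x.
by rewrite (le_trans (fM x))// ler_wpM2r// ltW.
Qed.

Lemma linear_bound_ex (K : numFieldType) (V W : normedModType K)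
    (f : {linear V -> W}) :
  continuous f -> exists2 M : K, 0 < M & forall x, `|f x| <= M * `|x|.
Proof.
by move=> /linear_bounded_continuous/linear_boundedP/pinfty_ex_gt0.
Qed.

Section dual_space.
Context {R : realType} (V : normedModType R[i]).

Definition dual_pred : {pred V -> R[i]^o} :=
  mem [set f : V -> R[i]^o | linear f /\ continuous f].

Lemma dual_predP (f : V -> R[i]^o) :
  reflect (linear f /\ continuous f) (f \in dual_pred).
Proof. by apply: (iffP idP); rewrite in_setE. Qed.

Lemma dual_submod_closed : submod_closed dual_pred.
Proof.
split=> [|a f g /dual_predP[lf cf] /dual_predP[lg cg]]; apply/dual_predP.
  by split=> [k x y|x]; [rewrite /GRing.zero/= scaler0 addr0|exact: cst_continuous].
split=> [k x y|x].
  rewrite {1 3 5}/GRing.add/= {1 3 5}/GRing.scale/= lf lg scalerDr.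
  rewrite (scalerDr k) addrACA; congr (_ + _ + (_ + _)).
  by rewrite !scalerA mulrC.
apply: continuousD; last exact: cg.
by apply: continuousZ; [exact: cst_continuous|exact: cf].
Qed.

HB.instance Definition _ :=
  GRing.isSubmodClosed.Build R[i] (V -> R[i]^o) dual_pred dual_submod_closed.

Record dual := Dual {
  dual_fun :> V -> R[i]^o;
  dual_funP : dual_fun \in dual_pred }.

HB.instance Definition _ := [isSub for dual_fun].
HB.instance Definition _ := [Choice of dual by <:].
HB.instance Definition _ := [SubChoice_isSubLmodule of dual by <:].

Lemma dual_linear (f : dual) : linear f.
Proof. by have /dual_predP[] := dual_funP f. Qed.

Lemma dual_continuous (f : dual) : continuous f.
Proof. by have /dual_predP[] := dual_funP f. Qed.

HB.instance Definition _ (f : dual) :=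
  GRing.isLinear.Build R[i] V R[i]^o _ (dual_fun f) (dual_linear f).

Definition dual_norm (f : dual) : R :=
  sup [set normc (f x) | x in [set x : V | `|x| <= 1]].

Lemma dual_normE (f : dual) (x : V) : (normc (f x))%:C = `|f x|.
Proof. exact: normcE. Qed.

Lemma dual_has_sup (f : dual) :
  has_sup [set normc (f x) | x in [set x : V | `|x| <= 1]].
Proof.
split; first by exists (normc (f 0)), 0 => //=; rewrite normr0.
have [M M0 fM] := linear_bound_ex (@dual_continuous f).
exists (complex.Re M) => _ [x /= x1 <-].
rewrite -lecR dual_normE (RRe_real (gtr0_real M0)).
by rewrite (le_trans (fM x))// ler_piMr// ltW.
Qed.

Lemma dual_norm_ub (f : dual) (x : V) :
  `|x| <= 1 -> normc (f x) <= dual_norm f.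
Proof. by move=> x1; apply: (sup_upper_bound (dual_has_sup f)); exists x. Qed.

Lemma dual_norm_le (f : dual) (M : R) :
  (forall x, `|x| <= 1 -> normc (f x) <= M) -> dual_norm f <= M.
Proof.
move=> fM; apply: ge_sup; first by case: (dual_has_sup f).
by move=> _ [x /= x1 <-]; exact: fM.
Qed.

Lemma dual_norm_ge0 (f : dual) : 0 <= dual_norm f.
Proof.
by rewrite (le_trans (normc_ge0 (f 0)))// dual_norm_ub// normr0.
Qed.

Lemma ler_dual_norm (f : dual) (x : V) : `|f x| <= (dual_norm f)%:C * `|x|.
Proof.
have [->|x0] := eqVneq x 0; first by rewrite raddf0 !normr0 mulr0.
have nx0 : 0 < `|x| by rewrite normr_gt0.
have y1 : `|(`|x|^-1 : R[i]) *: x| <= 1.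
  by rewrite normrZ normfV normr_id mulVf// gt_eqF.
have := dual_norm_ub f y1; rewrite -lecR dual_normE linearZ/= normrZ.
by rewrite normfV normr_id mulrC ler_pdivrMr.
Qed.

Let dual_normD (f g : dual) :
  (dual_norm (f + g))%:C <= (dual_norm f)%:C + (dual_norm g)%:C.
Proof.
rewrite -rmorphD lecR; apply: dual_norm_le => x x1.
apply: (@le_trans _ _ (normc (f x) + normc (g x))).
  by rewrite -lecR rmorphD/= !normcE; exact: ler_normD.
by apply: lerD; exact: dual_norm_ub.
Qed.

Let dual_normZ_le (l : R[i]) (f : dual) :
  dual_norm (l *: f) <= normc l * dual_norm f.
Proof.
apply: dual_norm_le => x x1.
rewrite [leLHS](_ : _ = normc l * normc (f x)); last first.
  exact: (normcM l (f x)).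
by apply: ler_wpM2l; [exact: normc_ge0|exact: dual_norm_ub].
Qed.

Let dual_normZ (l : R[i]) (f : dual) :
  (dual_norm (l *: f))%:C = `|l| * (dual_norm f)%:C.
Proof.
rewrite -normcE -rmorphM; congr (_%:C); apply/eqP; rewrite eq_le.
rewrite dual_normZ_le/=.
have [->|l0] := eqVneq l 0; first by rewrite normc0 mul0r dual_norm_ge0.
have nl0 : 0 < normc l.
  by rewrite lt_neqAle normc_ge0 andbT eq_sym; apply/eqP => /eq0_normc/eqP; exact/negP.
rewrite -ler_pdivlMl// -normcV.
by rewrite -[in leLHS](scale1r f) -(mulVf l0) -scalerA dual_normZ_le.
Qed.

Let dual_norm0_eq0 (f : dual) : (dual_norm f)%:C = 0 -> f = 0.
Proof.
move=> f0; apply/val_inj/funext => x /=.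
have := ler_dual_norm f x; rewrite f0 mul0r normr_le0 => /eqP ->.
by [].
Qed.

HB.instance Definition _ := Lmodule_isNormed.Build R[i] dual
  dual_normD dual_normZ dual_norm0_eq0.

End dual_space.
Arguments dual {R} V.

Section weak_amenability.
Context {R : realType}.
Implicit Type A : banachAlgType R[i].

Lemma bmull_continuous A (a : A) : continuous (fun x : A => bmul x a).
Proof.
pose f := HB.pack_for {linear A -> A} (fun x : A => bmul x a)
  (GRing.isLinear.Build R[i] A A _ (fun x : A => bmul x a)
    (fun k x y => etrans (bmulDl _ _ _) (congr1 (+%R^~ _) (bmulZl _ _ _)))).
apply: (@linear_boundW _ _ _ f `|a|) => // x.
by rewrite mulrC; exact: ler_norm_bmul.
Qed.

Lemma bmulr_continuous A (a : A) : continuous (fun x : A => bmul a x).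
Proof.
pose f := HB.pack_for {linear A -> A} (fun x : A => bmul a x)
  (GRing.isLinear.Build R[i] A A _ (fun x : A => bmul a x)
    (fun k x y => etrans (bmulDr _ _ _) (congr1 (+%R^~ _) (bmulZr _ _ _)))).
by apply: (@linear_boundW _ _ _ f `|a|) => // x; exact: ler_norm_bmul.
Qed.

Lemma dual_lact_subproof A (a : A) (phi : dual A) :
  (fun x => phi (bmul x a)) \in dual_pred (V := A).
Proof.
apply/dual_predP; split=> [k x y|x].
  by rewrite bmulDl bmulZl linearP.
by apply: (@continuous_comp _ _ _ (fun x => bmul x a) phi); [exact: bmull_continuous|exact: dual_continuous].
Qed.

Lemma dual_ract_subproof A (a : A) (phi : dual A) :
  (fun x => phi (bmul a x)) \in dual_pred (V := A).
Proof.
apply/dual_predP; split=> [k x y|x].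
  by rewrite bmulDr bmulZr linearP.
by apply: (@continuous_comp _ _ _ (bmul a) phi); [exact: bmulr_continuous|exact: dual_continuous].
Qed.

Definition dual_lact A (a : A) (phi : dual A) : dual A :=
  Dual (dual_lact_subproof a phi).

Definition dual_ract A (phi : dual A) (a : A) : dual A :=
  Dual (dual_ract_subproof a phi).

Definition bounded_derivation A (D : {linear A -> dual A}) :=
  (exists M : R, forall a : A, `|D a| <= M%:C * `|a|) /\
  forall a b : A, D (bmul a b) = dual_lact a (D b) + dual_ract (D a) b.

Definition ad A (phi : dual A) (a : A) : dual A :=
  dual_lact a phi - dual_ract phi a.

Definition weakly_amenable A :=
  forall D : {linear A -> dual A}, bounded_derivation D ->
    exists phi : dual A, forall a, D a = ad phi a.

End weak_amenability.

Section sequence_spaces.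
Context {R : realType} {I : choiceType}.
Implicit Type x : I -> R[i]^o.

Definition c00 : set (I -> R[i]^o) := [set x | finite_set [set i | x i != 0]].

Definition linfty : set (I -> R[i]^o) :=
  [set x | exists M : R, forall i, normc (x i) <= M].

Definition linfty_norm x : R := sup [set normc (x i) | i in [set: I]].

Definition lp_sum (p : R) x : \bar R := \esum_(i in [set: I]) (normc (x i) `^ p)%:E.

Definition lp_space (p : R) : set (I -> R[i]^o) := [set x | lp_sum p x < +oo]%E.

Definition lp_norm (p : R) x : R := fine (lp_sum p x) `^ p^-1.

End sequence_spaces.

(* A Banach space of functions on I is represented by a Banach space together
   with the linear injection [lat_fun] reading an element as a function on I;
   the functions belonging to it form the set [range lat_fun]. *)
Record seqLattice (R : realType) (I : choiceType) := SeqLattice {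
  lat_space :> completeNormedModType R[i];
  lat_fun : {linear lat_space -> (I -> R[i]^o)};
  lat_fun_inj : injective lat_fun;
  lat_c00 : c00 `<=` range lat_fun;
  lat_linfty : range lat_fun `<=` linfty;
  lat_c00_dense : dense (lat_fun @^-1` c00);
  lat_solid : forall (y : lat_space) (x : I -> R[i]^o), linfty x ->
    (forall i, `|x i| <= `|lat_fun y i|) ->
    exists2 x' : lat_space, lat_fun x' = x & `|x'| <= `|y|;
  lat_norm_ge : forall x : lat_space, (linfty_norm (lat_fun x))%:C <= `|x|
}.

Section lattice_theory.
Context {R : realType} {I : choiceType} (E : seqLattice R I).

Definition is_lp (p : R) :=
  range (lat_fun E) = lp_space p /\
  forall x : E, `|x| = (lp_norm p (lat_fun E x))%:C.

(* the element of E whose associated function is x (0 if there is none) *)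
Definition lat_elt (x : I -> R[i]^o) : E := xget 0 (lat_fun E @^-1` [set x]).

Lemma lat_eltK (x : I -> R[i]^o) : range (lat_fun E) x ->
  lat_fun E (lat_elt x) = x.
Proof. by move=> [e _ ex]; exact: (@xgetI _ 0 (lat_fun E @^-1` [set x]) e). Qed.

Lemma lat_fun_eltK : cancel (lat_fun E) lat_elt.
Proof. by move=> e; apply: (@lat_fun_inj _ _ E); apply: lat_eltK; exists e. Qed.

Lemma lat_funD (x y : E) i :
  lat_fun E (x + y) i = lat_fun E x i + lat_fun E y i.
Proof. by rewrite linearD. Qed.

Lemma lat_funZ (k : R[i]) (x : E) i : lat_fun E (k *: x) i = k * lat_fun E x i.
Proof. by rewrite linearZ. Qed.

Lemma lat_fun_le (x : E) (i : I) : `|lat_fun E x i| <= `|x|.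
Proof.
apply: le_trans (lat_norm_ge x); rewrite -normcE lecR.
have [M xM] : linfty (lat_fun E x) by apply: lat_linfty; exists x.
apply: ub_le_sup; last by exists i.
by exists M => _ [j _ <-].
Qed.

Lemma lat_dominated (x : I -> R[i]^o) (y : E) :
  (forall i, `|x i| <= `|lat_fun E y i|) ->
  exists2 x' : E, lat_fun E x' = x & `|x'| <= `|y|.
Proof.
move=> xy; apply: lat_solid => //; exists (complex.Re (`|y| : R[i])) => i.
by rewrite -lecR normRe normcE (le_trans (xy i))// lat_fun_le.
Qed.

Lemma range_lat_dominated (x : I -> R[i]^o) (y : E) :
  (forall i, `|x i| <= `|lat_fun E y i|) -> range (lat_fun E) x.
Proof. by move=> /lat_dominated[x' <- _]; exists x'. Qed.

Lemma lat_elt_le (x : I -> R[i]^o) (y : E) :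
  (forall i, `|x i| <= `|lat_fun E y i|) -> `|lat_elt x| <= `|y|.
Proof. by move=> /lat_dominated[x' <- ?]; rewrite lat_fun_eltK. Qed.

End lattice_theory.

Section geometric_completeness.
Context {R : realType}.
Local Notation h := (2^-1 : R[i]).

Let h_gt0 n : 0 < h ^+ n.
Proof. by rewrite exprn_gt0// invr_gt0 ltr0n. Qed.

Lemma half_expn_lt (e : R[i]) : 0 < e ->
  exists N, forall n, (N <= n)%N -> h ^+ n < e.
Proof.
move=> e0; have er := RRe_real (gtr0_real e0).
have r0 : 0 < complex.Re e by rewrite -ltcR er.
exists (Num.bound (complex.Re e)^-1) => n /upper_nthrootP.
rewrite -[X in _ < X -> _]invrK ltf_pV2 ?posrE ?invr_gt0 ?exprn_gt0// -exprVn.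
by rewrite -ltcR er rmorphXn/= fmorphV rmorph_nat.
Qed.

Let geometric_dist (V : normedModType R[i]) (u : nat -> V) n k :
  (forall m, `|u m.+1 - u m| <= h ^+ m) ->
  `|u (n + k)%N - u n| <= 2 * (h ^+ n - h ^+ (n + k)).
Proof.
move=> uh; elim: k => [|k IH]; first by rewrite addn0 !subrr normr0 mulr0.
rewrite addnS -[X in `|X|](subrKA (u (n + k)%N)) (le_trans (ler_normD _ _))//.
rewrite (le_trans (lerD (uh _) IH))// exprS.
have -> : 2 * (h ^+ n - h * h ^+ (n + k)) = 2 * h ^+ n - h ^+ (n + k).
  by rewrite mulrBr mulrA divff ?mul1r// pnatr_eq0.
rewrite mulrBr [2 * h ^+ (n + k)]mulr_natl mulr2n opprD addrC -!addrA.
by rewrite addNr addr0.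
Qed.

Lemma geometric_cvg (V : completeNormedModType R[i]) (u : nat -> V) :
  (forall n, `|u n.+1 - u n| <= h ^+ n) ->
  exists l, forall e, 0 < e ->
    exists N, forall n, (N <= n)%N -> `|l - u n| < e.
Proof.
move=> uh; suff /cauchy_cvg/cvg_ex[l ul] : cauchy (u @ \oo).
  by exists l => e e0; have [N _ uN] := cvgr_dist_lt u l ul e e0; exists N.
apply: cauchy_exP => e e0.
have [N hN] := half_expn_lt (divr_gt0 e0 (ltr0n _ 2)).
exists (u N); exists N => // n /= Nn; rewrite -ball_normE/= distrC.
rewrite -(subnKC Nn) (le_lt_trans (geometric_dist N (n - N) uh))//.
rewrite -ltr_pdivlMl// (@le_lt_trans _ _ (h ^+ N))//.
  by rewrite gerBl ltW.
by rewrite mulrC hN.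
Qed.

Lemma geometric_complete (V : normedModType R[i]) :
  (forall u : nat -> V, (forall n, `|u n.+1 - u n| <= h ^+ n) ->
    exists l, forall e, 0 < e ->
      exists N, forall n, (N <= n)%N -> `|l - u n| < e) ->
  forall F : set_system V, ProperFilter F -> cauchy F -> cvg F.
Proof.
move=> Vc F FF /cauchyP Fc.
have /choice[u uF] n := Fc _ (h_gt0 n.+2).
have [n|l ul] := Vc u.
  have [z []] := filter_ex (filterI (uF n.+1) (uF n)).
  rewrite -!ball_normE/= => z1 z0.
  rewrite -(subrKA z) (le_trans (ler_normD _ _))// [X in _ + X]distrC.
  rewrite (le_trans (lerD (ltW z1) (ltW z0)))//.
  have hh m : h ^+ m.+1 <= h ^+ m.
    by rewrite exprS ler_piMl ?(ltW (h_gt0 _))// invf_le1 ?ler1n ?ltr0n.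
  apply: (@le_trans _ _ (h ^+ n.+2 + h ^+ n.+2)).
    by apply: lerD => //; exact: hh.
  have h2 : h + h = 1 by rewrite [RHS]splitr !div1r.
  by rewrite exprS -mulrDl h2 mul1r hh.
apply/cvg_ex; exists l; apply/fcvgrPdist_lt => e e0.
have e20 : 0 < e / 2 by rewrite divr_gt0.
have [N lN] := ul _ e20; have [M hM] := half_expn_lt e20.
pose n := maxn N M.
apply: filterS (uF n) => z; rewrite -ball_normE/= => zn.
rewrite -(subrKA (u n)) (le_lt_trans (ler_normD _ _))// [e]splitr ltrD//.
  by rewrite lN// leq_maxl.
by rewrite (lt_trans zn)// hM// (leq_trans (leq_maxr N M))// leqW.
Qed.

End geometric_completeness.

Section direct_sum.
Context {R : realType} {I : choiceType} (E : seqLattice R I).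
Variable A : I -> banachAlgType R[i].
Implicit Types f g : forall i, A i.

Definition norm_family f : I -> R[i]^o := fun i => `|f i|.

Record Esum := MkEsum {
  Esum_fun :> forall i, A i;
  Esum_funP : range (lat_fun E) (norm_family Esum_fun) }.

HB.instance Definition _ := gen_eqMixin Esum.
HB.instance Definition _ := gen_choiceMixin Esum.

Implicit Types a b c : Esum.

Lemma Esum_eq a b : (forall i, a i = b i) -> a = b.
Proof.
case: a b => [a aP] [b bP] /= ab.
have {}ab : a = b by apply: functional_extensionality_dep.
by subst b; congr MkEsum; exact: Prop_irrelevance.
Qed.

Definition Esum_norm a : R[i] := `|lat_elt E (norm_family a)|.

Definition Esum_val a : E := lat_elt E (norm_family a).

Lemma Esum_valE a i : lat_fun E (Esum_val a) i = `|a i|.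
Proof. by rewrite lat_eltK//; exact: Esum_funP. Qed.

Lemma Esum_dominated f (y : E) :
  (forall i, `|f i| <= `|lat_fun E y i|) -> range (lat_fun E) (norm_family f).
Proof.
by move=> fy; apply: (@range_lat_dominated _ _ _ _ y) => i; rewrite normr_id.
Qed.

Lemma Esum_norm_le a (y : E) :
  (forall i, `|a i| <= `|lat_fun E y i|) -> Esum_norm a <= `|y|.
Proof. by move=> ay; apply: lat_elt_le => i; rewrite normr_id. Qed.

Lemma Esum_coord_le a i : `|a i| <= Esum_norm a.
Proof.
by have := lat_fun_le (Esum_val a) i; rewrite Esum_valE normr_id.
Qed.

Lemma Esum0_subproof : range (lat_fun E) (norm_family (fun i => 0)).
Proof. by apply: (@Esum_dominated _ 0) => i; rewrite normr0. Qed.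

Lemma EsumN_subproof a : range (lat_fun E) (norm_family (fun i => - a i)).
Proof.
by apply: (@Esum_dominated _ (Esum_val a)) => i; rewrite normrN Esum_valE normr_id.
Qed.

Let EsumD_le a b i :
  `|a i + b i| <= `|lat_fun E (Esum_val a + Esum_val b) i|.
Proof.
by rewrite lat_funD !Esum_valE [leRHS]ger0_norm ?addr_ge0// ler_normD.
Qed.

Lemma EsumD_subproof a b :
  range (lat_fun E) (norm_family (fun i => a i + b i)).
Proof. exact/Esum_dominated/EsumD_le. Qed.

Let EsumZ_le (k : R[i]) a i :
  `|k *: a i| <= `|lat_fun E (k *: Esum_val a) i|.
Proof.
by rewrite lat_funZ Esum_valE normrZ normrM normr_id.
Qed.

Lemma EsumZ_subproof (k : R[i]) a :
  range (lat_fun E) (norm_family (fun i => k *: a i)).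
Proof. exact/Esum_dominated/EsumZ_le. Qed.

Let EsumM_le a b i :
  `|bmul (a i) (b i)| <= `|lat_fun E (Esum_norm a *: Esum_val b) i|.
Proof.
rewrite lat_funZ Esum_valE [leRHS]normrM normr_id normr_id.
by rewrite (le_trans (ler_norm_bmul _ _))// ler_wpM2r// Esum_coord_le.
Qed.

Lemma EsumM_subproof a b :
  range (lat_fun E) (norm_family (fun i => bmul (a i) (b i))).
Proof. exact/Esum_dominated/EsumM_le. Qed.

Definition Esum_zero := MkEsum Esum0_subproof.
Definition Esum_opp a := MkEsum (EsumN_subproof a).
Definition Esum_add a b := MkEsum (EsumD_subproof a b).
Definition Esum_scale k a := MkEsum (EsumZ_subproof k a).
Definition Esum_mul a b := MkEsum (EsumM_subproof a b).

Let EsumA : associative Esum_add.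
Proof. by move=> a b c; apply: Esum_eq => i /=; rewrite addrA. Qed.

Let EsumC : commutative Esum_add.
Proof. by move=> a b; apply: Esum_eq => i /=; rewrite addrC. Qed.

Let Esum0 : left_id Esum_zero Esum_add.
Proof. by move=> a; apply: Esum_eq => i /=; rewrite add0r. Qed.

Let EsumN : left_inverse Esum_zero Esum_opp Esum_add.
Proof. by move=> a; apply: Esum_eq => i /=; rewrite addNr. Qed.

HB.instance Definition _ := GRing.isZmodule.Build Esum EsumA EsumC Esum0 EsumN.

Let EsumZA k l a : Esum_scale k (Esum_scale l a) = Esum_scale (k * l) a.
Proof. by apply: Esum_eq => i /=; rewrite scalerA. Qed.

Let EsumZ1 : left_id 1 Esum_scale.
Proof. by move=> a; apply: Esum_eq => i /=; rewrite scale1r. Qed.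

Let EsumZDr : right_distributive Esum_scale +%R.
Proof. by move=> k a b; apply: Esum_eq => i /=; rewrite scalerDr. Qed.

Let EsumZDl a : {morph Esum_scale^~ a : k l / k + l}.
Proof. by move=> k l; apply: Esum_eq => i /=; rewrite scalerDl. Qed.

HB.instance Definition _ :=
  GRing.Zmodule_isLmodule.Build R[i] Esum EsumZA EsumZ1 EsumZDr EsumZDl.

Let Esum_normD a b : Esum_norm (a + b) <= Esum_norm a + Esum_norm b.
Proof.
by rewrite (le_trans (@Esum_norm_le (a + b) _ (EsumD_le a b)))// ler_normD.
Qed.

Let Esum_normZ_le (k : R[i]) a : Esum_norm (k *: a) <= `|k| * Esum_norm a.
Proof. by rewrite (le_trans (@Esum_norm_le (k *: a) _ (EsumZ_le k a)))// normrZ. Qed.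

Let Esum_normZ (k : R[i]) a : Esum_norm (k *: a) = `|k| * Esum_norm a.
Proof.
apply/eqP; rewrite eq_le Esum_normZ_le/=.
have [->|k0] := eqVneq k 0; first by rewrite normr0 mul0r normr_ge0.
rewrite -ler_pdivlMl ?normr_gt0// -normfV.
by rewrite -[in leLHS](scale1r a) -(mulVf k0) -scalerA Esum_normZ_le.
Qed.

Let Esum_norm0_eq0 a : Esum_norm a = 0 -> a = 0.
Proof.
move=> a0; apply: Esum_eq => i; apply/eqP; rewrite -normr_le0 -a0.
exact: Esum_coord_le.
Qed.

HB.instance Definition _ := Lmodule_isNormed.Build R[i] Esum
  Esum_normD Esum_normZ Esum_norm0_eq0.

Lemma Esum_normE a : `|a| = `|lat_elt E (norm_family a)|.
Proof. by []. Qed.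

Let Esum_geometric_cvg (u : nat -> Esum) :
  (forall n, `|u n.+1 - u n| <= (2^-1 : R[i]) ^+ n) ->
  exists l : Esum, forall e, 0 < e ->
    exists N, forall n, (N <= n)%N -> `|l - u n| < e.
Proof.
move=> uh.
pose S n : E := \sum_(k < n) Esum_val (u k.+1 - u k).
have [|s sS] := @geometric_cvg _ E S.
  by move=> n; rewrite /S big_ord_recr/= addrAC subrr add0r; exact: uh.
have uS n m i : `|u (n + m)%N i - u n i| <= `|lat_fun E (S (n + m)%N - S n) i|.
  suff [x [x0 Sx ux]] : exists x : R[i], [/\ 0 <= x,
      lat_fun E (S (n + m)%N - S n) i = x & `|u (n + m)%N i - u n i| <= x].
    by rewrite Sx [leRHS]ger0_norm.
  elim: m => [|m [x [x0 Sx ux]]].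
    by exists 0; rewrite addn0 !subrr linear0 normr0.
  exists (`|(u (n + m).+1 - u (n + m)%N) i| + x); split.
  - by rewrite addr_ge0.
  - rewrite addnS {1}/S big_ord_recr/= addrAC lat_funD addrC.
    by rewrite Esum_valE Sx.
  - rewrite addnS -(subrKA (u (n + m)%N i)) (le_trans (ler_normD _ _))//.
    by rewrite lerD.
have lex i : exists li : A i, forall e, 0 < e ->
    exists N, forall n, (N <= n)%N -> `|li - u n i| < e.
  apply: (@geometric_cvg _ (A i) (fun n => u n i)) => n.
  by rewrite (le_trans _ (uh n))//; exact: (Esum_coord_le (u n.+1 - u n)).
pose l i := projT1 (cid (lex i)); have ul i := projT2 (cid (lex i)).
have lS n i : `|l i - u n i| <= `|lat_fun E (s - S n) i|.
  apply/ler_addgt0Pr => e e0.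
  have e20 : 0 < e / 2 by rewrite divr_gt0.
  have [N lN] := ul i _ e20; have [M sM] := sS _ e20.
  pose m := maxn N M.
  have Nm : (N <= n + m)%N by rewrite (leq_trans (leq_maxl N M))// leq_addl.
  have Mm : (M <= n + m)%N by rewrite (leq_trans (leq_maxr N M))// leq_addl.
  rewrite -(subrKA (u (n + m)%N i)) (le_trans (ler_normD _ _))//.
  rewrite (le_trans (lerD (ltW (lN _ Nm)) (uS _ _ _)))//.
  rewrite -(subrKA s (S (n + m)%N)) lat_funD.
  rewrite (le_trans (lerD (lexx _) (ler_normD _ _)))// addrA addrC.
  rewrite lerD2l [in leRHS](splitr e) lerD2l.
  by rewrite (le_trans (lat_fun_le _ _))// distrC ltW// sM.
have lP : range (lat_fun E) (norm_family (fun i => l i - u 0%N i)).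
  exact: (@Esum_dominated _ (s - S 0%N) (lS 0%N)).
pose L : Esum := MkEsum lP + u 0%N.
have LE n i : (L - u n) i = l i - u n i by rewrite /L /= subrK.
exists L => e e0; have [N sN] := sS e e0; exists N => n Nn.
by rewrite (le_lt_trans _ (sN _ Nn))//; apply: Esum_norm_le => i; rewrite LE lS.
Qed.

HB.instance Definition _ := Uniform_isComplete.Build Esum
  (@geometric_complete _ Esum Esum_geometric_cvg).

Let EsumMA : associative Esum_mul.
Proof. by move=> a b c; apply: Esum_eq => i /=; rewrite bmulA. Qed.

Let EsumMDl : left_distributive Esum_mul +%R.
Proof. by move=> a b c; apply: Esum_eq => i /=; rewrite bmulDl. Qed.

Let EsumMDr : right_distributive Esum_mul +%R.
Proof. by move=> a b c; apply: Esum_eq => i /=; rewrite bmulDr. Qed.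

Let EsumMZl (k : R[i]) a b : Esum_mul (k *: a) b = k *: Esum_mul a b.
Proof. by apply: Esum_eq => i /=; rewrite bmulZl. Qed.

Let EsumMZr (k : R[i]) a b : Esum_mul a (k *: b) = k *: Esum_mul a b.
Proof. by apply: Esum_eq => i /=; rewrite bmulZr. Qed.

Let Esum_normM a b : `|Esum_mul a b| <= `|a| * `|b|.
Proof.
rewrite (le_trans (@Esum_norm_le (Esum_mul a b) _ (EsumM_le a b)))//.
by rewrite normrZ normr_id.
Qed.

HB.instance Definition _ := CompleteNormedModule_isBanachAlgebra.Build R[i] Esum
  EsumMA EsumMDl EsumMDr EsumMZl EsumMZr Esum_normM.

End direct_sum.

(* Main.v *)
(* For (1), a derivation [D] of [A_i] lifts to [a |-> (x |-> D a_i x_i)] on the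
   sum, and restricting an implementing functional to the i-th summand
   implements [D].

   For (2), the diagonal blocks of a derivation of the sum are inner, hence zero
   by commutativity. For [i <> j] and [x] in [A_j], the functional
   [g a = D (incl_i a) (incl_j x)] kills products, so [a |-> g a *: g] is a
   derivation of [A_i]; being inner it satisfies [g a ^ 2 = 0]. Finitely
   supported families are dense, so [D = 0].

   For (3), choose a commutator [z != 0] in [B], a functional [phi] with
   [phi z != 0] and distinct indices [i_n]. With weights
   [c_n = (n+1)^-(1-1/p)], the form
   [(a, x) |-> sum_n c_n phi (x_{i_n} a_{i_n} - a_{i_n} x_{i_n})] is bounded on
   [l_p x l_p] because [c] lies in [l_{p/(p-2)}] (in [l_oo] if [p <= 2]). If
   [psi] implemented this derivation, evaluating it on
   [sum_{n<N} (n+1)^-(1/p) incl_{i_n} z] would give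
   [H_N |phi z| <= |psi| |z| H_N^(1/p)] for the harmonic sums [H_N], which are
   unbounded. *)
Require Import Defs.
From HB Require Import structures.
From mathcomp Require Import all_boot all_order all_algebra.
From mathcomp Require Import all_classical all_reals all_analysis.
From mathcomp Require Import complex.
From mathcomp Require Import ring lra.

Set Implicit Arguments.
Unset Strict Implicit.
Unset Printing Implicit Defensive.

Import Order.TTheory GRing.Theory Num.Theory.
Import numFieldNormedType.Exports.
Import Normc.

Local Open Scope classical_set_scope.
Local Open Scope ring_scope.
Local Open Scope complex_scope.

(** * The Hahn-Banach theorem *)

Section Hahn_Banach.
Context {R : realType} {V : lmodType R}.
Implicit Types p q : V -> R.

Definition sublinear q :=
  (forall x y, q (x + y) <= q x + q y) /\
  (forall t x, 0 <= t -> q (t *: x) = t * q x).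

Lemma sublinear0 q : sublinear q -> q 0 = 0.
Proof. by move=> [_ qZ]; rewrite -(scale0r 0) qZ// mul0r. Qed.

Lemma sublinearN q x : sublinear q -> - q (- x) <= q x.
Proof.
move=> qs; have := qs.1 x (- x); rewrite subrr (sublinear0 qs).
by move=> ?; lra.
Qed.

(** A lower bound depending only on [p], which keeps pointwise infima of sublinear functionals below
    [p] finite. *)
Lemma sublinear_le_anti p q x : sublinear q -> (forall y, q y <= p y) ->
  - p (- x) <= q x.
Proof. by move=> /(@sublinearN _ x) + /(_ (- x)); lra. Qed.

(* A positively homogeneous bound is enough: [q (t x) <= t q x] applied to
   [t^-1] gives the converse inequality. *)
Lemma sublinearP q : q 0 = 0 -> (forall x y, q (x + y) <= q x + q y) ->
  (forall t x, 0 < t -> q (t *: x) <= t * q x) -> sublinear q.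
Proof.
move=> q0 qD qZ; split=> // t x; rewrite le_eqVlt => /predU1P[<-|t0].
  by rewrite scale0r mul0r.
apply/eqP; rewrite eq_le qZ//= -ler_pdivlMl//.
by rewrite -[in leLHS](scale1r x) -(mulVf (lt0r_neq0 t0)) -scalerA qZ ?invr_gt0.
Qed.

(* The largest sublinear functional below [q] taking the value [- q v]
   at [- v]. *)
Definition push q v x := inf [set q (x + t *: v) - t * q v | t in [set t | 0 <= t]].

Lemma push_le q v x t : sublinear q -> 0 <= t ->
  push q v x <= q (x + t *: v) - t * q v.
Proof.
move=> qs t0; apply: ge_inf; last by exists t.
(* Since [s * q v = q (s *: v)] and [s *: v] is the sum of [x + s *: v] and [- x], subadditivity
   gives this lower bound. *)
exists (- q (- x)) => _ [s s0 <-].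
have := qs.1 (x + s *: v) (- x); rewrite addrAC subrr add0r qs.2//.
by move=> ?; lra.
Qed.

Lemma le_push q v x r : (forall t, 0 <= t -> r <= q (x + t *: v) - t * q v) ->
  r <= push q v x.
Proof.
move=> rq; apply: lb_le_inf; last by move=> _ [t t0 <-]; exact: rq.
by exists (q (x + 0 *: v) - 0 * q v), 0 => /=.
Qed.

Lemma push_le_self q v x : sublinear q -> push q v x <= q x.
Proof.
by move=> /(@push_le _ v x 0)/(_ (lexx _)); rewrite scale0r addr0 mul0r subr0.
Qed.

(** Parameters [t] and [s] for two vectors combine to [t + s] for their sum, and scaling a vector by
    [t] turns a parameter [s] into [t * s], so the infimum inherits both properties. *)
Lemma push_sublinear q v : sublinear q -> sublinear (push q v).
Proof.
move=> qs; apply: sublinearP.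
- apply/eqP; rewrite eq_le; apply/andP; split.
    by rewrite (le_trans (push_le_self _ _ qs))// (sublinear0 qs).
  by apply: le_push => t t0; rewrite add0r qs.2// subrr.
- move=> x y; rewrite -lerBlDr; apply: le_push => t t0.
  rewrite lerBlDr -lerBlDl; apply: le_push => s s0.
  rewrite lerBlDl; apply: le_trans (push_le v (x + y) qs (addr_ge0 t0 s0)) _.
  rewrite scalerDl addrACA; have := qs.1 (x + t *: v) (y + s *: v).
  by move=> ?; rewrite mulrDl; lra.
- move=> t x t0; rewrite -ler_pdivrMl//; apply: le_push => s s0.
  rewrite ler_pdivrMl//.
  have := push_le v (t *: x) qs (mulr_ge0 (ltW t0) s0).
  by rewrite -scalerA -scalerDr (qs.2 _ _ (ltW t0)) mulrBr mulrA.
Qed.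

(* A minimal sublinear functional is linear, since it equals all its pushes. *)
Lemma minimal_sublinear_linear q : sublinear q ->
  (forall q', sublinear q' -> (forall x, q' x <= q x) -> q' = q) ->
  forall t x y, q (t *: x + y) = t * q x + q y.
Proof.
move=> qs qmin.
have qD x y : q (x + y) = q x + q y.
  apply/eqP; rewrite eq_le qs.1/= -lerBrDr.
  rewrite -[in leLHS](qmin _ (push_sublinear y qs)); last first.
    by move=> z; exact: push_le_self.
  by have := push_le y x qs ler01; rewrite scale1r mul1r.
have qN x : q (- x) = - q x.
  by apply/eqP; rewrite -addr_eq0 -qD addNr (sublinear0 qs).
move=> t x y; rewrite qD; congr (_ + _).
have [t0|t0] := leP 0 t; first exact: qs.2.
by rewrite -[t]opprK scaleNr qN qs.2 ?mulNr// oppr_ge0 ltW.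
Qed.

(** Zorn's lemma for the reversed pointwise order on the sublinear functionals below [p]; a chain is
    bounded by its pointwise infimum. *)
Lemma minimal_sublinear_exists p : sublinear p ->
  exists q, [/\ sublinear q, forall x, q x <= p x &
    forall q', sublinear q' -> (forall x, q' x <= q x) -> q' = q].
Proof.
move=> ps.
pose T := {q : V -> R | sublinear q /\ forall x, q x <= p x}.
pose le (q q' : T) := `[< forall x, sval q' x <= sval q x >].
have [||||q qmax] := @Zorn T le.
- by move=> q; apply/asboolP.
- move=> q r s /asboolP qr /asboolP rs; apply/asboolP => x.
  exact: le_trans (rs x) (qr x).
- move=> [q qP] [r rP] /asboolP/= qr /asboolP/= rq.
  apply: eq_exist => /=; apply/funext => x.
  by apply/eqP; rewrite eq_le qr rq.
- move=> A Atot.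
  (* The empty chain is bounded by [p] itself. *)
  have [[q0 Aq0]|A0] := pselect (A !=set0); last first.
    by exists (exist _ p (conj ps (fun=> lexx _))) => s As; case: A0; exists s.
  pose m x := inf [set sval (q : T) x | q in A].
  have m_le (q : T) x : A q -> m x <= sval q x.
    move=> Aq; apply: ge_inf; last by exists q.
    exists (- p (- x)) => _ [[r [rs rp]] Ar <-] /=.
    exact: sublinear_le_anti.
  have le_m r x : (forall q : T, A q -> r <= sval q x) -> r <= m x.
    move=> rA; apply: lb_le_inf; last by move=> _ [q Aq <-]; exact: rA.
    by exists (sval q0 x), q0.
  have ms : sublinear m.
    apply: sublinearP.
    + apply/eqP; rewrite eq_le; apply/andP; split.
        rewrite (le_trans (m_le q0 _ Aq0))// sublinear0//.
        exact: (svalP q0).1.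
      apply: (le_m) => q _; rewrite sublinear0//; exact: (svalP q).1.
    + move=> x y; rewrite -lerBlDr; apply: (le_m) => q Aq.
      rewrite lerBlDr -lerBlDl; apply: (le_m) => r Ar.
      rewrite lerBlDl.
      (* The chain condition enters here: subadditivity of the smaller of [q] and [r] bounds
         [m (x + y)] by [q x + r y]. *)
      have [/asboolP qr|/asboolP rq] := Atot _ _ Aq Ar.
        rewrite (le_trans (m_le r _ Ar))// (le_trans ((svalP r).1.1 x y))//.
        by rewrite lerD2r.
      rewrite (le_trans (m_le q _ Aq))// (le_trans ((svalP q).1.1 x y))//.
      by rewrite lerD2l.
    + move=> t x t0; rewrite -ler_pdivrMl//; apply: (le_m) => q Aq.
      rewrite ler_pdivrMl// (le_trans (m_le q _ Aq))//.
      by rewrite (svalP q).1.2// ltW.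
  have mp x : m x <= p x by rewrite (le_trans (m_le q0 _ Aq0))// (svalP q0).2.
  exists (exist _ m (conj ms mp)) => q Aq; apply/asboolP => x /=.
  exact: m_le.
exists (sval q); split.
- exact: (svalP q).1.
- exact: (svalP q).2.
- move=> q' q's q'q.
  have q'p x : q' x <= p x by rewrite (le_trans (q'q x))// (svalP q).2.
  by rewrite -(qmax (exist _ q' (conj q's q'p)))//; apply/asboolP.
Qed.

(** Minimality is taken below [push p v] rather than [p]. At [- v], the parameter [1] gives
    [u (- v) <= - p v], so linearity forces [u v = p v]. *)
Theorem Hahn_Banach p v : sublinear p ->
  exists u : V -> R, [/\ forall t x y, u (t *: x + y) = t * u x + u y,
    forall x, u x <= p x & u v = p v].
Proof.
move=> ps; have [u [us up umin]] := minimal_sublinear_exists (push_sublinear v ps).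
have ul := minimal_sublinear_linear us umin.
exists u; split=> // [x|]; first by rewrite (le_trans (up x))// push_le_self.
apply/eqP; rewrite eq_le (le_trans (up v)) ?push_le_self//=.
have := le_trans (up (- v)) (push_le v (- v) ps ler01).
rewrite scale1r addNr (sublinear0 ps) mul1r sub0r.
by have := ul (-1) v 0; rewrite scaleN1r addr0 (sublinear0 us) addr0 mulN1r => ->; lra.
Qed.

End Hahn_Banach.

(** * Real and imaginary parts against the modulus *)

Section complex_abs.
Context {R : realType}.
Implicit Type z : R[i].

Lemma normr_Re_le z : `|complex.Re z| <= normc z.
Proof. by rewrite -lecR Defs.normcE; exact: normc_ge_Re. Qed.

Lemma normr_realc (t : R) : `|t%:C| = `|t|%:C.
Proof. by rewrite normc_def/= expr0n addr0 sqrtr_sqr. Qed.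

Lemma normc_i : `|'i%C : R[i]| = 1.
Proof. by rewrite normc_def/= expr0n expr1n add0r sqrtr1. Qed.

Lemma normr_Im_le z : `|complex.Im z| <= normc z.
Proof.
rewrite -normrN -ReiNIm (le_trans (normr_Re_le _))//.
by rewrite -lecR !Defs.normcE normrM normc_i mulr1.
Qed.

Lemma normc_le_ReIm z : normc z <= `|complex.Re z| + `|complex.Im z|.
Proof.
rewrite -lecR Defs.normcE {1}(complexE z) rmorphD/= (le_trans (ler_normD _ _))//.
by rewrite normrM normc_i mul1r !normr_realc.
Qed.

End complex_abs.

(** * Construction of functionals, and separation of points by the dual *)

Section dual_space_construction.
Context {R : realType}.

Lemma dual_ext (V : normedModType R[i]) (phi psi : dual V) :
  (forall x, phi x = psi x) -> phi = psi.
Proof. by move=> e; apply/val_inj/funext. Qed.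

Lemma dual_addE (V : normedModType R[i]) (phi psi : dual V) x :
  (phi + psi) x = phi x + psi x.
Proof. by []. Qed.

Lemma dual_scaleE (V : normedModType R[i]) (k : R[i]) (phi : dual V) x :
  (k *: phi) x = k * phi x.
Proof. by []. Qed.

Lemma dual_eval_linear (V W : normedModType R[i]) (D : {linear V -> dual W}) x :
  linear (fun a => D a x : R[i]^o).
Proof. by move=> k a b; rewrite (linearP D) dual_addE dual_scaleE. Qed.

Lemma bounded_linear_dual (V : normedModType R[i]) (f : V -> R[i]^o) (M : R[i]) :
  M \is Num.real -> linear f -> (forall x, `|f x| <= M * `|x|) ->
  exists phi : dual V, forall x, phi x = f x.
Proof.
move=> Mr fl fM.
pose F := HB.pack_for {linear V -> R[i]^o} f
  (GRing.isLinear.Build R[i] V R[i]^o _ f fl).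
have fP : f \in dual_pred (V := V).
  by apply/dual_predP; split=> //; exact: (@linear_boundW _ _ _ F M).
by exists (Dual fP).
Qed.

(** Currying: a bounded bilinear form is turned into a bounded map to the dual. *)
Lemma bilinear_dual (V : normedModType R[i]) (b : V -> V -> R[i]^o) (M : R) :
  0 <= M -> (forall a, linear (b a)) -> (forall x, linear (b^~ x)) ->
  (forall a x, `|b a x| <= M%:C * `|a| * `|x|) ->
  exists2 D : {linear V -> dual V}, forall a x, D a x = b a x &
    forall a, `|D a| <= M%:C * `|a|.
Proof.
move=> M0 bl br bM.
have /choice[D DE] a : exists phi : dual V, forall x, phi x = b a x.
  apply: (@bounded_linear_dual _ _ (M%:C * `|a|)) => //.
  by rewrite ger0_real// mulr_ge0// lecR.
have Dl : linear D.
  by move=> k x y; apply: dual_ext => z; rewrite DE br -!DE.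
exists (HB.pack_for {linear V -> dual V} D
  (GRing.isLinear.Build R[i] V (dual V) _ D Dl)) => //= a.
have -> : M%:C * `|a| = (M * complex.Re `|a|)%:C by rewrite rmorphM/= normRe.
rewrite [`|D a|]/(dual_norm (D a))%:C lecR; apply: dual_norm_le => x x1.
rewrite -lecR Defs.normcE DE (le_trans (bM _ _))// rmorphM/= normRe.
by rewrite ler_piMr// mulr_ge0// lecR.
Qed.

(** An alias carrying only real scalars, so that the real [Hahn_Banach] applies to a complex
    space. *)
Definition realified (V : lmodType R[i]) : Type := V.

Section realified.
Variable V : lmodType R[i].
HB.instance Definition _ := GRing.Zmodule.on (realified V).
Let scale (t : R) (x : realified V) : realified V := (t%:C : R[i]) *: (x : V).
Let scaleA s t x : scale s (scale t x) = scale (s * t) x.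
Proof. by rewrite /scale scalerA rmorphM. Qed.
Let scale1 : left_id 1 scale.
Proof. by move=> x; rewrite /scale scale1r. Qed.
Let scaleDr : right_distributive scale +%R.
Proof. by move=> t x y; rewrite /scale scalerDr. Qed.
Let scaleDl x : {morph scale^~ x : s t / s + t}.
Proof. by move=> s t; rewrite /scale rmorphD scalerDl. Qed.
HB.instance Definition _ := GRing.Zmodule_isLmodule.Build R (realified V)
  scaleA scale1 scaleDr scaleDl.
End realified.

(** Real Hahn-Banach for the norm gives a real functional [u] with [u z] equal to the norm of [z];
    it is then completed to a complex one. *)
Lemma dual_separates (V : normedModType R[i]) (z : V) :
  z != 0 -> exists phi : dual V, phi z != 0.
Proof.
move=> z0.
pose p (x : realified V) : R := complex.Re (`|x : V| : R[i]).
have pE x : (p x)%:C = `|x : V| by exact: normRe.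
have ps : sublinear p.
  split=> [x y|t x t0]; last first.
    by apply/(@complexI R); rewrite rmorphM/= !pE [LHS]normrZ ger0_norm ?lecR.
  by rewrite -lecR rmorphD/= !pE; exact: (ler_normD (x : V) y).
have [u [ul up uz]] := Hahn_Banach (z : realified V) ps.
have uD x y : u (x + y) = u x + u y by have := ul 1 x y; rewrite scale1r mul1r.
have u0 : u 0 = 0.
  have := uD 0 0; rewrite addr0 => /eqP.
  by rewrite -subr_eq0 opprD addrA subrr sub0r oppr_eq0 => /eqP.
have uZ (t : R) (x : V) : u ((t%:C : R[i]) *: x) = t * u x.
  by have := ul t x 0; rewrite u0 !addr0.
have uN (x : V) : u (- x) = - u x.
  by have := uZ (-1) x; rewrite rmorphN rmorph1 scaleN1r mulN1r.
have upn x : `|u x| <= p x.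
  rewrite ler_norml up andbT lerNl -uN (le_trans (up _))//.
  by rewrite -lecR !pE [leLHS](normrN (x : V)).
(* A complex linear map with real part [u] must satisfy [Im (f x) = - Re (f (i x))]. *)
pose f (x : V) : R[i]^o := u x +i* - u ('i%C *: x).
have fl : linear f.
  move=> [a b] x y; rewrite /f.
  have kE : (a +i* b) = a%:C + b%:C * 'i%C :> R[i].
    by apply/eqP; rewrite eq_complex/=; apply/andP; split; apply/eqP; ring.
  have ikE : 'i%C * (a +i* b) = a%:C * 'i%C + (- b)%:C :> R[i].
    by apply/eqP; rewrite eq_complex/=; apply/andP; split; apply/eqP; ring.
  rewrite scalerDr scalerA ikE kE !scalerDl -!scalerA.
  rewrite !uD !uZ; apply/eqP; rewrite eq_complex/=; apply/andP; split; apply/eqP; ring.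
(* The constant 2 adds the bounds on the real and imaginary parts; multiplication by [i] preserves
   the norm. *)
have [|phi phiE] := @bounded_linear_dual _ f 2 (realn _ 2) fl.
  move=> x; rewrite -Defs.normcE -pE.
  have -> : 2 = 2%:C :> R[i] by rewrite rmorph_nat.
  rewrite -rmorphM lecR /f.
  have pi : p ('i%C *: x) = p x.
    by apply/(@complexI R); rewrite !pE normrZ normc_i mul1r.
  have := upn x; have := upn ('i%C *: x); rewrite pi => h1 h2.
  rewrite (le_trans (normc_le_ReIm _))//= normrN.
  by rewrite mulr_natl mulr2n lerD.
exists phi; rewrite phiE /f eq_complex/= negb_and uz.
by rewrite -(inj_eq (@complexI R)) pE normr_eq0 z0.
Qed.

End dual_space_construction.

(** * Inclusions of the summands *)

Section Esum_inclusion.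
Context {R : realType} {I : choiceType} (E : seqLattice R I).
Variable A : I -> banachAlgType R[i].
Local Notation S := (Esum E A).

Lemma Esum_zeroE i : (0 : S) i = 0.
Proof. by []. Qed.

Lemma Esum_oppE (a : S) i : (- a) i = - a i.
Proof. by []. Qed.

Lemma Esum_addE (a b : S) i : (a + b) i = a i + b i.
Proof. by []. Qed.

Lemma Esum_scaleE (k : R[i]) (a : S) i : (k *: a) i = k *: a i.
Proof. by []. Qed.

Lemma Esum_mulE (a b : S) i : bmul a b i = bmul (a i) (b i).
Proof. by []. Qed.

Let unit_fun (i : I) : I -> R[i]^o := fun j => (j == i)%:R.

(** The [i]-th unit vector of [E]. Its norm may exceed 1, hence it appears as a factor in the bounds
    on inclusions. *)
Definition lat_unit (i : I) : E := lat_elt E (unit_fun i).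

Lemma lat_unitE i j : lat_fun E (lat_unit i) j = (j == i)%:R.
Proof.
rewrite lat_eltK//; apply: lat_c00; apply: (@sub_finite_set _ _ [set i]) => //.
by move=> k /=; rewrite /unit_fun; have [->//|_] := eqVneq k i; rewrite eqxx.
Qed.

Let incl_fun i (x : A i) : forall j, A j := dfwith (fun j => 0 : A j) i x.

Let incl_fun_le i (x : A i) j :
  `|incl_fun x j| <= `|lat_fun E (`|x| *: lat_unit i) j|.
Proof.
rewrite lat_funZ lat_unitE /incl_fun; have [->|ji] := eqVneq j i.
  by rewrite dfwithin mulr1 normr_id.
by rewrite dfwithout ?normr0// eq_sym.
Qed.

Definition Esum_incl i (x : A i) : S := MkEsum (Esum_dominated (incl_fun_le x)).

Lemma Esum_incl_eq i (x : A i) : Esum_incl x i = x.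
Proof. exact: dfwithin. Qed.

Lemma Esum_incl_neq i j (x : A i) : j != i -> Esum_incl x j = 0.
Proof. by move=> ji; rewrite /= /incl_fun dfwithout// eq_sym. Qed.

Lemma Esum_incl_norm i (x : A i) : `|Esum_incl x| <= `|x| * `|lat_unit i|.
Proof.
have := @Esum_norm_le _ _ _ _ (Esum_incl x) (`|x| *: lat_unit i).
by rewrite normrZ normr_id; apply => j; exact: incl_fun_le.
Qed.

Lemma Esum_incl_linear i : linear (@Esum_incl i).
Proof.
move=> k x y; apply: Esum_eq => j; rewrite Esum_addE Esum_scaleE.
have [->|ji] := eqVneq j i; first by rewrite !Esum_incl_eq.
by rewrite !Esum_incl_neq// scaler0 addr0.
Qed.

HB.instance Definition _ i :=
  GRing.isLinear.Build R[i] (A i) S _ (@Esum_incl i) (@Esum_incl_linear i).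

Lemma bmul_incll (a : S) i (x : A i) :
  bmul (Esum_incl x) a = Esum_incl (bmul x (a i)).
Proof.
apply: Esum_eq => j; rewrite Esum_mulE.
have [->|ji] := eqVneq j i; first by rewrite !Esum_incl_eq.
rewrite !Esum_incl_neq//.
by have := bmulZl 0 (0 : A j) (a j); rewrite !scale0r.
Qed.

Lemma bmul_incl_eq i (x y : A i) :
  bmul (Esum_incl x) (Esum_incl y) = Esum_incl (bmul x y).
Proof. by rewrite bmul_incll Esum_incl_eq. Qed.

Lemma bmul_incl_neq i j (x : A i) (y : A j) :
  i != j -> bmul (Esum_incl x) (Esum_incl y) = 0.
Proof.
move=> ij; rewrite bmul_incll Esum_incl_neq//.
by have := bmulZr 0 x (0 : A i); rewrite !scale0r => ->; rewrite linear0.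
Qed.

Lemma dual_incl (phi : dual S) i :
  exists psi : dual (A i), forall x, psi x = phi (Esum_incl x).
Proof.
apply: (@bounded_linear_dual _ _ _ (`|phi| * `|lat_unit i|)).
- by rewrite realM ?normr_real.
- by move=> k x y; rewrite linearP linearP.
- move=> x; rewrite (le_trans (ler_dual_norm _ _))// -mulrA.
  by rewrite ler_wpM2l ?(normr_ge0 phi)// mulrC Esum_incl_norm.
Qed.

End Esum_inclusion.

(** * Weak amenability in terms of bounded bilinear forms *)

Section derivations.
Context {R : realType}.

Lemma adE (A : banachAlgType R[i]) (phi : dual A) a x :
  ad phi a x = phi (bmul x a) - phi (bmul a x).
Proof. by []. Qed.

Lemma derivationE (A : banachAlgType R[i]) (D : {linear A -> dual A}) :
  bounded_derivation D ->
  forall a b x, D (bmul a b) x = D b (bmul x a) + D a (bmul b x).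
Proof. by move=> [_ DM] a b x; rewrite DM. Qed.

(** The working form of weak amenability: derivations are handled as scalar-valued forms
    [(a, x) |-> D a x]. *)
Lemma weakly_amenable_bilinear (A : banachAlgType R[i]) (b : A -> A -> R[i]^o)
    (M : R) : weakly_amenable A -> 0 <= M ->
  (forall a, linear (b a)) -> (forall x, linear (b^~ x)) ->
  (forall a x, `|b a x| <= M%:C * `|a| * `|x|) ->
  (forall a c x, b (bmul a c) x = b c (bmul x a) + b a (bmul c x)) ->
  exists phi : dual A, forall a x, b a x = phi (bmul x a) - phi (bmul a x).
Proof.
move=> wA M0 bl br bM bD; have [D DE Dn] := bilinear_dual M0 bl br bM.
have [|phi phiE] := wA D.
  split; first by exists M.
  by move=> a c; apply: dual_ext => x; rewrite dual_addE /= !DE bD.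
by exists phi => a x; rewrite -DE phiE adE.
Qed.

Lemma derivation_bound (A : banachAlgType R[i]) (D : {linear A -> dual A}) :
  bounded_derivation D ->
  exists2 M : R, 0 <= M & forall a x, `|D a x| <= M%:C * `|a| * `|x|.
Proof.
move=> [[M DM] _]; exists (Num.max M 0); first by rewrite le_max lexx orbT.
move=> a x; rewrite (le_trans (ler_dual_norm _ _))// ler_wpM2r//.
by rewrite (le_trans (DM a))// ler_wpM2r// lecR le_max lexx.
Qed.

End derivations.

(** * Passage between the sum and its summands, and the commutative case *)

Section summands.
Context {R : realType} {I : choiceType} (E : seqLattice R I).
Variable A : I -> banachAlgType R[i].
Local Notation S := (Esum E A).

Lemma weakly_amenable_summand i : weakly_amenable S -> weakly_amenable (A i).
Proof.
move=> wS D Dder; have [M M0 DM] := derivation_bound Dder.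
have [a k x y|x k a b|a x|a b x|phi phiE] :=
  @weakly_amenable_bilinear _ S (fun a x => D (a i) (x i)) M wS M0.
- exact: (linearP (D (a i))).
- by rewrite Esum_addE Esum_scaleE; exact: dual_eval_linear.
- rewrite (le_trans (DM _ _))// -!mulrA ler_wpM2l ?lecR//.
  by rewrite ler_pM//; exact: Esum_coord_le.
- exact: derivationE.
have [psi psiE] := dual_incl phi i.
exists psi => a; apply: dual_ext => x.
have := phiE (Esum_incl E a) (Esum_incl E x).
by rewrite adE !psiE !bmul_incl_eq !Esum_incl_eq.
Qed.

(* The rank-one map [a |-> g a *: g] is a derivation when [g] kills products,
   and an inner derivation satisfies [D a a = 0]. *)
Lemma weakly_amenable_products (B : banachAlgType R[i]) (g : B -> R[i]^o) (M : R) :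
  weakly_amenable B -> 0 <= M -> linear g -> (forall a, `|g a| <= M%:C * `|a|) ->
  (forall a b, g (bmul a b) = 0) -> forall a, g a = 0.
Proof.
move=> wB M0 gl gM g0 a.
have [c k x y|x k c d|c x|c d x|phi phiE] :=
  @weakly_amenable_bilinear _ B (fun a x => g a * g x) (M * M) wB (mulr_ge0 M0 M0).
- by rewrite gl mulrDr; congr (_ + _); rewrite mulrCA.
- by rewrite gl mulrDl; congr (_ + _); rewrite -mulrA.
- rewrite normrM rmorphM/= -mulrA mulrACA.
  by rewrite ler_pM.
- by rewrite !g0 !mulr0 mul0r addr0.
by apply/eqP; rewrite -[_ == _]orbb -mulf_eq0 phiE subrr.
Qed.

Lemma Esum_sum_incl (a : S) (s : seq I) j : uniq s ->
  (\sum_(i <- s) Esum_incl E (a i)) j = if j \in s then a j else 0.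
Proof.
move=> us; rewrite (big_morph (fun b : S => b j)
  (fun b c => Esum_addE b c j) (Esum_zeroE _ _ j)).
case: ifPn => [js|js].
  rewrite (bigD1_seq j)// Esum_incl_eq big1 => [|i ij]; first exact: addr0.
  by rewrite Esum_incl_neq// eq_sym.
rewrite big_seq big1// => i si; rewrite Esum_incl_neq//.
by apply: contraNneq js => ->.
Qed.

(** Density is given in [E] only: the norm family of [a] is approximated by a finitely supported
    [y], and [a] is cut off to the support of [y]. Off that support [y] vanishes, so the error is
    dominated coordinatewise by the norm family minus [y]. *)
Lemma Esum_finite_dense (a : S) (e : R[i]) : 0 < e ->
  exists s : seq I, `|a - \sum_(i <- s) Esum_incl E (a i)| < e.
Proof.
move=> e0.
have [y [/= ye yc]] : ball (Esum_val a) e `&` (lat_fun E @^-1` c00) !=set0.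
  apply: (@lat_c00_dense _ _ E); first by exists (Esum_val a); exact: ballxx.
  exact: ball_open.
have /finite_seqP[s ys] : finite_set [set i | lat_fun E y i != 0] := yc.
exists (undup s); rewrite -ball_normE/= in ye.
apply: le_lt_trans ye; apply: Esum_norm_le => j.
rewrite Esum_addE Esum_oppE Esum_sum_incl ?undup_uniq// mem_undup.
case: ifPn => [js|js]; first by rewrite subrr normr0.
have -> : lat_fun E (Esum_val a - y) j = `|a j| - lat_fun E y j.
  by rewrite linearB -Esum_valE.
have -> : lat_fun E y j = 0.
  by apply/eqP; apply: contraNT js => yj; have : [set` s] j by rewrite -ys.
by rewrite !subr0 normr_id.
Qed.

Lemma dual_Esum0 (phi : dual S) :
  (forall i (x : A i), phi (Esum_incl E x) = 0) -> forall a, phi a = 0.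
Proof.
move=> phi0 a; apply/eqP; apply/negPn/negP => pa.
(* Adding 1 keeps the tolerance well defined when [phi] has norm 0. *)
have dpos : 0 < `|phi| + 1 by rewrite ltr_wpDl.
have pa0 : 0 < `|phi a| by rewrite normr_gt0.
have [s sa] := Esum_finite_dense a (divr_gt0 pa0 dpos).
have ps : phi (\sum_(i <- s) Esum_incl E (a i)) = 0.
  by rewrite linear_sum big1// => i _; exact: phi0.
have := ler_dual_norm phi (a - \sum_(i <- s) Esum_incl E (a i)).
rewrite linearB/= ps subr0 => pa_le.
rewrite ltr_pdivlMr// in sa; have := lt_le_trans sa pa_le.
by rewrite mulrC mulrDl mul1r gtrDl normr_lt0.
Qed.

Lemma commutative_derivation0 :
  (forall i, commutative (@bmul _ (A i)) /\ weakly_amenable (A i)) ->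
  forall D : {linear S -> dual S}, bounded_derivation D -> forall a, D a = 0.
Proof.
move=> cwA D Dder; have [M M0 DM] := derivation_bound Dder.
have DMe := derivationE Dder.
have Ren0 (V : normedModType R[i]) (v : V) : 0 <= complex.Re (`|v| : R[i]).
  by rewrite -lecR normRe; exact: normr_ge0.
have U0 i := Ren0 _ (lat_unit E i).
have incl_le i (x : A i) :
    `|Esum_incl E x| <= (complex.Re `|lat_unit E i|)%:C * `|x|.
  by rewrite normRe mulrC Esum_incl_norm.
have Dlin x := dual_eval_linear D x.
(* Each of the two inclusions contributes one factor, the norm of [lat_unit i], to the bound. *)
have Ddiag i (a x : A i) : D (Esum_incl E a) (Esum_incl E x) = 0.
  have [b k y z|y k b c|b y|b c y|phi phiE] := @weakly_amenable_bilinear _ (A i)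
    (fun a x => D (Esum_incl E a) (Esum_incl E x))
    (M * complex.Re `|lat_unit E i| * complex.Re `|lat_unit E i|) (cwA i).2
    (mulr_ge0 (mulr_ge0 M0 (U0 i)) (U0 i)).
  - by rewrite !linearP.
  - by rewrite (linearP (@Esum_incl _ _ E A i)) Dlin.
  - rewrite (le_trans (DM _ _))// !rmorphM/=.
    rewrite -!mulrA ler_wpM2l ?lecR// mulrA mulrACA.
    by rewrite ler_pM// incl_le.
  - by rewrite -!bmul_incl_eq DMe.
  by rewrite phiE (cwA i).1 subrr.
have Doff i j (a : A i) (x : A j) : i != j -> D (Esum_incl E a) (Esum_incl E x) = 0.
  move=> ij; pose g (b : A i) := D (Esum_incl E b) (Esum_incl E x).
  apply: (@weakly_amenable_products _ g
    (M * complex.Re `|lat_unit E i| * complex.Re `|Esum_incl E x|) (cwA i).2).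
  - exact: mulr_ge0 (mulr_ge0 M0 (U0 i)) (Ren0 _ _).
  - by move=> k b c; rewrite /g (linearP (@Esum_incl _ _ E A i)) Dlin.
  - move=> b; rewrite (le_trans (DM _ _))// !rmorphM/= [X in _ <= _ * X * _]normRe.
    by rewrite [leRHS]mulrAC ler_wpM2r// -mulrA ler_wpM2l ?lecR ?incl_le.
  (* Both terms of the derivation identity contain a product of elements from different summands. *)
  - move=> b c; rewrite /g -bmul_incl_eq DMe.
    by rewrite !bmul_incl_neq// 1?eq_sym// !linear0 addr0.
move=> a; apply: dual_ext => x.
(* Density is used twice: first in the argument of [D] with [x] fixed, then in [x]. *)
have Mxr : M%:C * `|x| \is Num.real by rewrite ger0_real// mulr_ge0// lecR.
have [|phi phiE] := bounded_linear_dual Mxr (Dlin x).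
  by move=> b; rewrite (le_trans (DM _ _))// mulrAC.
rewrite -phiE; apply: dual_Esum0 => i {}a; rewrite phiE.
apply: dual_Esum0 => j y.
have [ij|] := eqVneq i j; last exact: Doff.
by move: y; rewrite -ij.
Qed.

End summands.

(** * The weights *)

Section real_weights.
Context {R : realType}.
Implicit Types (t p : R) (u v : nat -> R).

(** A discrete mean value inequality, from [1 + x <= expR x] alone: it gives
    [m <= (m + 1) * expR (- (m + 1)^-1)]; raise this to the power [- t] and apply it once more. *)
Lemma powR_telescope t (m : R) : 0 < t -> 0 < m ->
  t * (m + 1) `^ (- (1 + t)) <= m `^ (- t) - (m + 1) `^ (- t).
Proof.
move=> t0 m0; have m10 : 0 < m + 1 by rewrite addr_gt0.
have le_m : m <= (m + 1) * expR (- (m + 1)^-1).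
  have := expR_ge1Dx (- (m + 1)^-1); rewrite -(ler_pM2l m10).
  by rewrite mulrDr mulrN divff ?gt_eqF// mulr1 addrK.
have {}le_m : (m + 1) `^ (- t) * expR (t / (m + 1)) <= m `^ (- t).
  rewrite !powRN -[expR _]invrK -expRN -invfM lef_pV2 ?posrE ?powR_gt0//; last first.
    by rewrite mulr_gt0 ?powR_gt0 ?expR_gt0.
  rewrite [t / _]mulrC -mulNr expRM -powRM ?expR_ge0//; last exact: ltW.
  apply: ge0_ler_powR => //; rewrite ?nnegrE; [exact: ltW|exact: ltW|].
  by rewrite mulr_ge0// ?expR_ge0 ?ltW.
rewrite lerBrDr (le_trans _ le_m)//.
rewrite opprD powRD; last by rewrite (gt_eqF m10) implybT.
rewrite powR_inv1 ?(ltW m10)// mulrA mulrC -[X in _ + X]mulr1 -mulrDr.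
by rewrite ler_pM2l ?powR_gt0// addrC expR_ge1Dx.
Qed.

Lemma sum_powR_le t N : 0 < t ->
  \sum_(0 <= n < N) (n.+1%:R : R) `^ (- (1 + t)) <= 1 + t^-1.
Proof.
move=> t0; case: N => [|N]; first by rewrite big_nil addr_ge0 ?invr_ge0 ?ltW.
(* The bound is strengthened so that the induction telescopes; the leading 1 is the term [n = 0]. *)
apply: (@le_trans _ _ (1 + t^-1 * (1 - N.+1%:R `^ (- t)))); last first.
  by rewrite lerD2l ler_piMr ?invr_ge0 ?(ltW t0)// gerBl powR_ge0.
elim: N => [|N IH].
  by rewrite big_nat1 !powR1 subrr mulr0 addr0.
rewrite big_nat_recr//= (le_trans (lerD IH (lexx _)))// -addrA lerD2l.
rewrite -(ler_pM2l t0) mulrDr !mulVKf ?gt_eqF// -[N.+2]addn1 natrD.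
have := @powR_telescope t N.+1%:R t0 (ltr0Sn _ _).
by lra.
Qed.

(* The weight lies in [l_r] for every [r > p / (p - 1)] but not in the dual
   exponent [p / (p - 1)] itself. *)
Definition weight p n : R := n.+1%:R `^ (- (1 - p^-1)).

Lemma weight_ge0 p n : 0 <= weight p n.
Proof. exact: powR_ge0. Qed.

Lemma weight_le1 p n : 1 < p -> weight p n <= 1.
Proof.
move=> p1; rewrite /weight -[leRHS](powRr0 n.+1%:R) ler_powR ?ler1n//.
by rewrite oppr_le0 subr_ge0 invf_le1// ?ltW// (lt_trans ltr01).
Qed.

Lemma sum_weight_sqr_le p : 1 < p -> exists2 C : R, 0 <= C &
  forall u N, (forall n, 0 <= u n) -> \sum_(0 <= n < N) u n `^ p <= 1 ->
    \sum_(0 <= n < N) weight p n * u n ^+ 2 <= C.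
Proof.
move=> p1; have p0 : 0 < p by rewrite (lt_trans ltr01).
have [p2|p2] := leP p 2.
  exists 1 => // u N u0 u1; apply: le_trans (u1).
  rewrite !big_mkord; apply: ler_sum => n _.
  rewrite (@le_trans _ _ (u n ^+ 2))//.
    by rewrite ler_piMl ?sqr_ge0// weight_le1.
  have [->|un0] := eqVneq (u n) 0; first by rewrite expr0n powR0// gt_eqF.
  have un : 0 < u n by rewrite lt_neqAle eq_sym un0 u0.
  rewrite -powR_mulrn// ger_powR// un leNgt; apply/negP => un1.
  have : u n `^ p <= 1.
    apply: le_trans u1; rewrite big_mkord (bigD1 n)//= lerDl sumr_ge0// => m _.
    exact: powR_ge0.
  by apply/negP; rewrite -ltNge (lt_le_trans un1)// le1r_powR// ltW.
have p20 : 0 < p - 2 by rewrite subr_gt0.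
exists (1 + (1 + (p - 2)^-1^-1)) => [|u N u0 u1].
  by rewrite !addr_ge0// !invr_ge0 ltW.
apply: le_trans (lerD u1 (@sum_powR_le (p - 2)^-1 N _)); last by rewrite invr_gt0.
rewrite -big_split/= !big_mkord; apply: ler_sum => n _; rewrite mulrC.
have P0 : 0 < p / 2 by rewrite divr_gt0.
have Q0 : 0 < p / (p - 2) by rewrite divr_gt0.
have PQ : (p / 2)^-1 + (p / (p - 2))^-1 = 1.
  by rewrite !invf_div -mulrDl addrC subrK divff// gt_eqF.
apply: le_trans (conjugate_powR (sqr_ge0 (u n)) (weight_ge0 p n) P0 Q0 PQ) _.
have -> : (u n ^+ 2) `^ (p / 2) = u n `^ p.
  by rewrite -powR_mulrn// -powRrM mulrC divfK.
have -> : weight p n `^ (p / (p - 2)) = n.+1%:R `^ (- (1 + (p - 2)^-1)).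
  rewrite /weight -powRrM; congr (_ `^ _).
  (* The exponent is [(1 - p^-1) * (p / (p - 2)) = (p - 1) / (p - 2) = 1 + (p - 2)^-1]. *)
  by field; rewrite !gt_eqF.
apply: lerD; rewrite ler_piMr ?powR_ge0//.
  by rewrite invf_le1// ler_pdivlMr// mul1r ltW.
by rewrite invf_le1// ler_pdivlMr// mul1r gerBl.
Qed.

(** Divide [u] by [a] and [v] by [b], then reduce to squares by the inequality of arithmetic and
    geometric means. When [a] or [b] is 0, the corresponding terms all vanish. *)
Lemma sum_weight_mul_le p : 1 < p -> exists2 C : R, 0 <= C &
  forall u v N (a b : R), (forall n, 0 <= u n) -> (forall n, 0 <= v n) ->
    0 <= a -> 0 <= b ->
    \sum_(0 <= n < N) u n `^ p <= a `^ p ->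
    \sum_(0 <= n < N) v n `^ p <= b `^ p ->
    \sum_(0 <= n < N) weight p n * (u n * v n) <= C * (a * b).
Proof.
move=> p1; have p0 : 0 < p by rewrite (lt_trans ltr01).
have [C C0 HC] := sum_weight_sqr_le p1; exists C => //.
have vanish u N : \sum_(0 <= n < N) u n `^ p <= 0 `^ p ->
    forall n : 'I_N, u n = 0.
  rewrite powR0 ?gt_eqF// big_mkord => us n; apply: (@powR_eq0_eq0 _ _ p).
  apply/eqP; rewrite eq_le powR_ge0 andbT (le_trans _ us)//.
  by rewrite (bigD1 n)//= lerDl sumr_ge0// => m _; exact: powR_ge0.
move=> u v N a b u0 v0; rewrite le_eqVlt => /predU1P[<- _ us _|a0].
  by rewrite mul0r mulr0 big_mkord big1// => n _; rewrite (vanish u N us) mul0r mulr0.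
rewrite le_eqVlt => /predU1P[<- _ vs|b0 us vs].
  by rewrite !mulr0 big_mkord big1// => n _; rewrite (vanish v N vs) !mulr0.
have normalize w (d : R) : (forall n, 0 <= w n) -> 0 < d ->
    \sum_(0 <= n < N) w n `^ p <= d `^ p ->
    \sum_(0 <= n < N) weight p n * (w n / d) ^+ 2 <= C.
  move=> w0 d0 wd; apply: HC => [n|]; first by rewrite divr_ge0// ltW.
  have E n : (w n / d) `^ p = w n `^ p / d `^ p.
    by rewrite powRM// ?invr_ge0 ?ltW// -powR_inv1 ?ltW// -powRrM mulN1r powRN.
  rewrite (eq_bigr _ (fun n _ => E n)) -mulr_suml ler_pdivrMr ?powR_gt0//.
  by rewrite mul1r.
rewrite -ler_pdivrMr ?mulr_gt0// mulr_suml.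
have := lerD (normalize _ _ u0 a0 us) (normalize _ _ v0 b0 vs).
rewrite -mulr2n -(ler_pM2r (_ : 0 < 2^-1)) ?invr_gt0// -[C *+ 2]mulr_natr mulfK//.
apply: le_trans; rewrite -big_split/= mulr_suml !big_mkord; apply: ler_sum => n _.
rewrite -subr_ge0.
have -> : (weight p n * (u n / a) ^+ 2 + weight p n * (v n / b) ^+ 2) / 2 -
    weight p n * (u n * v n) / (a * b) =
    weight p n * ((u n / a - v n / b) ^+ 2 / 2).
  by field; rewrite !gt_eqF.
by rewrite mulr_ge0 ?weight_ge0// divr_ge0// sqr_ge0.
Qed.

(* [H <= K H^(1/p)] forces [H <= K^q] with [1/p + 1/q = 1]. *)
Lemma harmonic_not_le_powR p (K : R) : 1 < p ->
  ~ forall N, \sum_(0 <= n < N) (n.+1%:R : R)^-1 <=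
      K * (\sum_(0 <= n < N) (n.+1%:R : R)^-1) `^ p^-1.
Proof.
move=> p1 HK; have p0 : 0 < p by rewrite (lt_trans ltr01).
have q0 : 0 < 1 - p^-1 by rewrite subr_gt0 invf_lt1.
apply: (@dvg_harmonic R); apply: nondecreasing_is_cvgn.
  apply/nondecreasing_seqP => n; rewrite !seriesEnat/= big_nat_recr//=.
  by rewrite lerDl invr_ge0.
exists (Num.max 0 (K `^ (1 - p^-1)^-1)) => _ [N _ <-]; rewrite seriesEnat/=.
set H := \sum_(_ <= _ < _) _.
rewrite le_max; have [//|H0] := leP H 0; rewrite /=.
have HKN : H `^ (1 - p^-1) <= K.
  have : H <= K * H `^ p^-1 := HK N.
  rewrite -ler_pdivrMr ?powR_gt0// -powRN -[X in X * _]powRr1 ?(ltW H0)//.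
  by rewrite -powRD// (gt_eqF H0) implybT.
have K0 : 0 <= K by apply: le_trans HKN; exact: powR_ge0.
have := ge0_ler_powR (_ : 0 <= (1 - p^-1)^-1) _ _ HKN.
rewrite -powRrM mulfV ?gt_eqF// powRr1 ?(ltW H0)//; apply; rewrite ?nnegrE//.
  by rewrite invr_ge0 ltW.
exact: powR_ge0.
Qed.

End real_weights.

(** * Absolutely summable complex sequences *)

Section abs_summable.
Context {R : realType}.
Implicit Type w : nat -> R[i].

Definition abs_sum_le w (M : R) :=
  forall N, \sum_(0 <= n < N) normc (w n) <= M.

(* Taken on real and imaginary parts, so that only completeness of [R] is used. *)
Definition csum w : R[i] :=
  limn (series (fun n => complex.Re (w n))) +i*
  limn (series (fun n => complex.Im (w n))).

Lemma series_bounded (v : nat -> R) (M : R) :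
  (forall N, \sum_(0 <= n < N) `|v n| <= M) ->
  cvgn (series v) /\ `|limn (series v)| <= M.
Proof.
move=> vM; have vc : cvgn [normed series v].
  apply: nondecreasing_is_cvgn; last first.
    by exists M => _ [N _ <-]; exact: vM.
  apply/nondecreasing_seqP => n.
  rewrite /normed_series_of !seriesEnat/= big_nat_recr//=.
  by rewrite lerDl.
split; first exact: normed_cvg.
apply: (le_trans (lim_series_norm vc)); apply: limr_le => //.
by near=> N; exact: vM.
Unshelve. all: by end_near. Qed.

Lemma abs_sum_le_Re w M : abs_sum_le w M ->
  cvgn (series (fun n => complex.Re (w n))) /\
  `|limn (series (fun n => complex.Re (w n)))| <= M.
Proof.
move=> wM; apply: series_bounded => N; apply: le_trans (wM N).
by rewrite !big_mkord; apply: ler_sum => n _; exact: normr_Re_le.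
Qed.

Lemma abs_sum_le_Im w M : abs_sum_le w M ->
  cvgn (series (fun n => complex.Im (w n))) /\
  `|limn (series (fun n => complex.Im (w n)))| <= M.
Proof.
move=> wM; apply: series_bounded => N; apply: le_trans (wM N).
by rewrite !big_mkord; apply: ler_sum => n _; exact: normr_Im_le.
Qed.

(** The factor 2 comes from bounding real and imaginary parts separately. *)
Lemma csum_bound w M : abs_sum_le w M -> `|csum w| <= (M *+ 2)%:C.
Proof.
move=> wM; rewrite -Defs.normcE lecR (le_trans (normc_le_ReIm _))//= mulr2n.
by rewrite lerD// ?(abs_sum_le_Re wM).2 ?(abs_sum_le_Im wM).2.
Qed.

Lemma csum_linear (k : R[i]) w1 w2 M1 M2 : abs_sum_le w1 M1 -> abs_sum_le w2 M2 ->
  csum (fun n => k * w1 n + w2 n) = k * csum w1 + csum w2.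
Proof.
move=> wM1 wM2; case: k => a b.
have [r1 _] := abs_sum_le_Re wM1; have [r2 _] := abs_sum_le_Re wM2.
have [i1 _] := abs_sum_le_Im wM1; have [i2 _] := abs_sum_le_Im wM2.
have reE (z z' : R[i]) : complex.Re ((a +i* b) * z + z') =
    a * complex.Re z - b * complex.Im z + complex.Re z'.
  by case: z z' => [c d] [e f].
have imE (z z' : R[i]) : complex.Im ((a +i* b) * z + z') =
    a * complex.Im z + b * complex.Re z + complex.Im z'.
  by case: z z' => [c d] [e f].
have rE : (fun n => complex.Re ((a +i* b) * w1 n + w2 n)) =
    a *: (fun n => complex.Re (w1 n)) - b *: (fun n => complex.Im (w1 n)) +
    (fun n => complex.Re (w2 n)).
  by apply/funext => n; rewrite reE.
have iE : (fun n => complex.Im ((a +i* b) * w1 n + w2 n)) =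
    a *: (fun n => complex.Im (w1 n)) + b *: (fun n => complex.Re (w1 n)) +
    (fun n => complex.Im (w2 n)).
  by apply/funext => n; rewrite imE.
rewrite /csum rE iE.
rewrite lim_seriesD//; last by apply: is_cvg_seriesB; exact: is_cvg_seriesZ.
rewrite lim_seriesB; [|exact: is_cvg_seriesZ|exact: is_cvg_seriesZ].
rewrite lim_seriesD//; last by apply: is_cvg_seriesD; exact: is_cvg_seriesZ.
rewrite lim_seriesD; [|exact: is_cvg_seriesZ|exact: is_cvg_seriesZ].
by rewrite !lim_seriesZ//; apply/eqP; rewrite eq_complex/= !eqxx.
Qed.

Lemma csum_single w m : (forall n, n != m -> w n = 0) -> csum w = w m.
Proof.
move=> w0.
have single (v : nat -> R) : (forall n, n != m -> v n = 0) -> limn (series v) = v m.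
  (* The partial sum up to [N] runs over [n < N], so it is constant from [m.+1] on. *)
  move=> v0; apply: lim_near_cst => //; exists m.+1 => // N /= mN.
  rewrite seriesEnat/= big_mkord (bigD1 (Ordinal mN))//= big1 ?addr0// => n nm.
  by rewrite v0//; apply: contraNneq nm => nm; exact/eqP/val_inj.
by rewrite /csum !single => [|n /w0->//|n /w0->//]; case: (w m).
Qed.

End abs_summable.

(** * Norms in [l_p]-sums, computed along a sequence of distinct indices *)

Section lp_sums.
Context {R : realType} {I : choiceType}.
Variables (p : R) (p1 : 1 < p).
Variable g : nat -> I.
Hypothesis g_inj : injective g.

Let p0 : 0 < p. Proof. exact: lt_trans ltr01 p1. Qed.

Lemma fsum_injective (F : I -> \bar R) N :
  (\sum_(i \in g @` `I_N) F i = \sum_(0 <= n < N) F (g n))%E.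
Proof.
rewrite big_mkord (fsbig_ord _ N (fun n => F (g n))); apply: reindex_fsbig.
by split => [n nN|x y _ _ /g_inj|i [n nN <-]] //=; exists n.
Qed.

Lemma lp_sum_ge (x : I -> R[i]^o) N :
  (\sum_(0 <= n < N) (normc (x (g n)) `^ p)%:E <= lp_sum p x)%E.
Proof.
rewrite -(fsum_injective (fun i => (normc (x i) `^ p)%:E)).
by apply: esum_ge; exists (g @` `I_N) => //; split=> //; exact: finite_image.
Qed.

Lemma lp_sum_finite (x : I -> R[i]^o) N :
  (forall i, ~ (g @` `I_N) i -> x i = 0) ->
  (lp_sum p x = \sum_(0 <= n < N) (normc (x (g n)) `^ p)%:E)%E.
Proof.
move=> x0; rewrite -(fsum_injective (fun i => (normc (x i) `^ p)%:E)).
rewrite -esum_fset; [|exact: finite_image|by move=> i _; rewrite lee_fin powR_ge0].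
rewrite [RHS]esum_mkcond; apply: eq_esum => i _; case: ifPn => //.
by rewrite notin_setE => /x0 ->; rewrite normc0 powR0// gt_eqF.
Qed.

Variables (E : seqLattice R I) (E_lp : is_lp E p).
Variable A : I -> banachAlgType R[i].
Local Notation S := (Esum E A).
Implicit Type a : S.

(** The norm is valued in [R[i]]; real powers need its real part. *)
Definition rnorm (V : normedModType R[i]) (v : V) : R := complex.Re (`|v| : R[i]).

Lemma Esum_lp_norm a : `|a| = (lp_norm p (norm_family a))%:C.
Proof. by rewrite Esum_normE (E_lp.2 _) lat_eltK//; exact: Esum_funP. Qed.

Lemma normc_norm_family a i : normc (norm_family a i) = rnorm (a i).
Proof. by apply/(@complexI R); rewrite Defs.normcE normr_id normRe. Qed.

Lemma Esum_lp_ge a N :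
  \sum_(0 <= n < N) rnorm (a (g n)) `^ p <= rnorm a `^ p.
Proof.
(* [fine] sends an infinite sum to 0, so finiteness must come first. *)
have fin : (lp_sum p (norm_family a) < +oo)%E.
  by have := Esum_funP a; rewrite E_lp.1.
have ge0 : (0 <= lp_sum p (norm_family a))%E.
  by apply: esum_ge0 => i _; rewrite lee_fin powR_ge0.
rewrite {2}/rnorm Esum_lp_norm/= /lp_norm -powRrM mulVf ?gt_eqF//.
rewrite powRr1 ?fine_ge0// -lee_fin fineK ?ge0_fin_numE//.
apply: le_trans (lp_sum_ge (norm_family a) N).
by rewrite -sumEFin; under [leRHS]eq_bigr do rewrite normc_norm_family.
Qed.

Lemma Esum_lp_finite a N : (forall i, ~ (g @` `I_N) i -> a i = 0) ->
  rnorm a = (\sum_(0 <= n < N) rnorm (a (g n)) `^ p) `^ p^-1.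
Proof.
move=> a0; rewrite /rnorm Esum_lp_norm/= /lp_norm (@lp_sum_finite _ N).
  rewrite sumEFin/=; congr (_ `^ _); apply: eq_bigr => n _.
  by rewrite normc_norm_family.
by move=> i /a0; rewrite /norm_family => ->; rewrite normr0.
Qed.

End lp_sums.

(** * A non-inner derivation of the l_p-sum *)

Section lp_not_weakly_amenable.
Context {R : realType} {I : choiceType} (E : seqLattice R I).
Variables (p : R) (p1 : 1 < p) (E_lp : is_lp E p).
Variables (g : nat -> I) (g_inj : injective g).
Variable B : banachAlgType R[i].
Local Notation S := (Esum E (fun=> B)).
Variable phi : dual B.

Let bracket (x a : B) : B := bmul x a - bmul a x.

Let bracket_linearl a : linear (bracket^~ a).
Proof.
by move=> k x y; rewrite /bracket bmulDl bmulDr bmulZl bmulZr scalerBr addrACA opprD.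
Qed.

Let bracket_linearr x : linear (bracket x).
Proof.
by move=> k a b; rewrite /bracket bmulDl bmulDr bmulZl bmulZr scalerBr addrACA opprD.
Qed.

(** The products [b x a] cancel. This identity makes each summand of the form satisfy the derivation
    rule. *)
Let bracket_derivation (a b x : B) :
  bracket x (bmul a b) = bracket (bmul x a) b + bracket (bmul b x) a.
Proof. by rewrite /bracket !bmulA addrA subrK. Qed.

Let term (a x : S) (n : nat) : R[i] :=
  (weight p n)%:C * phi (bracket (x (g n)) (a (g n))).

Definition commutator_sum (a x : S) : R[i]^o := csum (term a x).

Let term_le : exists2 M : R, 0 <= M &
  forall a x, abs_sum_le (term a x) (M * (rnorm a * rnorm x)).
Proof.
have [C C0 HC] := sum_weight_mul_le p1.
have rn0 (V : normedModType R[i]) (v : V) : 0 <= rnorm v.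
  by rewrite -lecR normRe; exact: normr_ge0.
have d0 := dual_norm_ge0 phi.
(* The 2 counts the two products in a commutator. *)
exists (dual_norm phi *+ 2 * C); first by rewrite mulr_ge0// mulrn_wge0.
move=> a x N.
have := HC (fun n => rnorm (a (g n))) (fun n => rnorm (x (g n))) N (rnorm a) (rnorm x)
  (fun n => rn0 _ _) (fun n => rn0 _ _) (rn0 _ _) (rn0 _ _)
  (Esum_lp_ge p1 g_inj E_lp a N) (Esum_lp_ge p1 g_inj E_lp x N).
move=> /(ler_wpM2l (mulrn_wge0 2 d0)); rewrite [X in _ <= X -> _]mulrA; apply: le_trans.
rewrite mulr_sumr !big_mkord; apply: ler_sum => n _.
rewrite mulrCA /term normcM.
rewrite (_ : normc (weight p n)%:C = weight p n); last first.
  by apply/(@complexI R); rewrite Defs.normcE normr_realc ger0_norm ?weight_ge0.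
rewrite ler_wpM2l ?weight_ge0// -lecR Defs.normcE.
rewrite (le_trans (ler_dual_norm _ _))// -mulr_natr -mulrA rmorphM/=.
rewrite ler_wpM2l ?lecR// /bracket (le_trans (ler_normB _ _))//.
rewrite rmorphM/= rmorph_nat mulr_natl mulr2n rmorphM/= !normRe.
by rewrite lerD// (le_trans (ler_norm_bmul _ _))// mulrC.
Qed.

Let term_linearl a k (x y : S) :
  term a (k *: x + y) = (fun n => k * term a x n + term a y n).
Proof.
apply/funext => n; rewrite /term Esum_addE Esum_scaleE bracket_linearl linearP.
by rewrite mulrDr mulrCA.
Qed.

Let term_linearr k (a b x : S) :
  term (k *: a + b) x = (fun n => k * term a x n + term b x n).
Proof.
apply/funext => n; rewrite /term Esum_addE Esum_scaleE bracket_linearr linearP.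
by rewrite mulrDr mulrCA.
Qed.

(** The factor [1] gives the right side the shape handled by [csum_linear]. *)
Let term_derivation (a b x : S) : term (bmul a b) x =
  (fun n => 1 * term b (bmul x a) n + term a (bmul b x) n).
Proof.
apply/funext => n; rewrite /term !Esum_mulE bracket_derivation linearD mulrDr.
by rewrite mul1r.
Qed.

Lemma commutator_sum_inner : weakly_amenable S ->
  exists psi : dual S, forall a x,
    commutator_sum a x = psi (bmul x a) - psi (bmul a x).
Proof.
have [M M0 tM] := term_le; move=> wS.
apply: (@weakly_amenable_bilinear _ S commutator_sum (M *+ 2) wS).
- exact: mulrn_wge0.
- move=> a k x y; rewrite /commutator_sum term_linearl.
  exact: csum_linear (tM _ _) (tM _ _).
- move=> x k a b; rewrite /commutator_sum term_linearr.
  exact: csum_linear (tM _ _) (tM _ _).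
- move=> a x; rewrite (le_trans (csum_bound (tM a x)))//.
  by rewrite -mulrnAl 2!rmorphM/= !normRe mulrA.
- move=> a b x; rewrite /commutator_sum term_derivation.
  by rewrite (csum_linear 1 (tM _ _) (tM _ _)) mul1r.
Qed.

Lemma commutator_sum_incl (x a : B) n :
  commutator_sum (Esum_incl E (a : (fun=> B) (g n)))
    (Esum_incl E (x : (fun=> B) (g n))) =
  (weight p n)%:C * phi (bracket x a).
Proof.
rewrite /commutator_sum (@csum_single _ _ n) => [|m mn].
  by rewrite /term !Esum_incl_eq.
have gmn : g m != g n by rewrite (inj_eq g_inj).
rewrite /term !Esum_incl_neq//.
have -> : bracket 0 0 = 0 by rewrite /bracket subrr.
by rewrite linear0 mulr0.
Qed.

Lemma inner_weights_bound (psi : dual S) (x a : B) :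
  (forall b y : S, commutator_sum b y = psi (bmul y b) - psi (bmul b y)) ->
  phi (bracket x a) != 0 ->
  exists K : R, forall N, \sum_(0 <= n < N) (n.+1%:R : R)^-1 <=
      K * (\sum_(0 <= n < N) (n.+1%:R : R)^-1) `^ p^-1.
Proof.
move=> psiE; set z := bracket x a => pz0.
have p0 : 0 < p by rewrite (lt_trans ltr01).
have psi_incl n : psi (Esum_incl E (z : (fun=> B) (g n))) = (weight p n)%:C * phi z.
  rewrite -commutator_sum_incl psiE !bmul_incl_eq -linearB.
  by congr (dual_fun psi _); exact: (linearB (@Esum_incl _ _ E (fun=> B) (g n))).
have nz : 0 < normc (phi z).
  by rewrite lt_neqAle normc_ge0 andbT eq_sym; apply: contra pz0 => /eqP/eq0_normc ->.
exists (dual_norm psi * rnorm z / normc (phi z)) => N.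
pose beta n : R := n.+1%:R `^ (- p^-1).
pose b : S := \sum_(0 <= n < N) (beta n)%:C *: Esum_incl E (z : (fun=> B) (g n)).
set H := \sum_(_ <= _ < _) _.
have psib : psi b = H%:C * phi z.
  rewrite /b linear_sum/= /H rmorph_sum/= mulr_suml; apply: eq_bigr => n _.
  rewrite linearZ/= psi_incl [LHS]mulrA -rmorphM; congr (_%:C * _).
  rewrite /beta /weight -powRD; last by rewrite pnatr_eq0 implybT.
  by rewrite opprB addKr powR_inv1.
have bE j : b j = \sum_(0 <= n < N) (beta n)%:C *: (Esum_incl E (z : (fun=> B) (g n)) j).
  rewrite /b (big_morph (fun c : S => c j) (fun c d => Esum_addE c d j) (Esum_zeroE _ _ j)).
  by [].
have bg n : (n < N)%N -> b (g n) = (beta n)%:C *: z.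
  move=> nN; rewrite bE big_mkord (bigD1 (Ordinal nN))// Esum_incl_eq.
  rewrite big1 => [|m mn]; first exact: addr0.
  by rewrite Esum_incl_neq ?scaler0// (inj_eq g_inj) eq_sym.
have b0 j : ~ (g @` `I_N) j -> b j = 0.
  move=> gj; rewrite bE big_mkord big1// => n _; rewrite Esum_incl_neq ?scaler0//.
  by apply/eqP => jn; apply: gj; exists (val n) => //=.
have rnz : 0 <= rnorm z by rewrite -lecR normRe; exact: normr_ge0.
have nb : rnorm b = rnorm z * H `^ p^-1.
  rewrite (Esum_lp_finite p1 g_inj E_lp b0).
  have -> : \sum_(0 <= n < N) rnorm (b (g n)) `^ p = rnorm z `^ p * H.
    rewrite /H mulr_sumr !big_mkord; apply: eq_bigr => n _; rewrite bg//.
    have -> : rnorm ((beta n)%:C *: z) = rnorm z * beta n.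
      apply/(@complexI R); rewrite normRe rmorphM/= normRe normrZ normr_realc.
      by rewrite ger0_norm ?powR_ge0// mulrC.
    rewrite powRM ?powR_ge0//; congr (_ * _).
    by rewrite /beta -powRrM mulNr mulVf ?gt_eqF// powR_inv1.
  rewrite powRM ?powR_ge0//; last by apply: sumr_ge0 => n _; rewrite invr_ge0.
  by rewrite -powRrM mulfV ?gt_eqF// powRr1.
have H0 : 0 <= H by apply: sumr_ge0 => n _; rewrite invr_ge0.
have := ler_dual_norm psi b.
rewrite psib normrM normr_realc -(normRe b) -[complex.Re _]/(rnorm b) nb.
rewrite -Defs.normcE -!rmorphM lecR ger0_norm// => Hle.
by rewrite mulrAC ler_pdivlMr// -mulrA.
Qed.

End lp_not_weakly_amenable.

Theorem theorem7p7 (R : realType) (I : choiceType) (I_neq0 : [set: I] !=set0)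
    (E : seqLattice R I) :
  [/\ forall A : I -> banachAlgType R[i],
        weakly_amenable (Esum E A) -> forall i, weakly_amenable (A i),
      forall A : I -> banachAlgType R[i],
        (forall i, commutative (@bmul _ (A i)) /\ weakly_amenable (A i)) ->
        weakly_amenable (Esum E A) /\
        forall D : {linear Esum E A -> dual (Esum E A)},
          bounded_derivation D -> forall a, D a = 0
    & forall p : R, 1 < p -> infinite_set [set: I] -> is_lp E p ->
      forall B : banachAlgType R[i],
        weakly_amenable B -> ~ commutative (@bmul _ B) ->
        ~ weakly_amenable (Esum E (fun _ => B))].
Proof.
split=> [A wS i|A cwA|p p1 I_inf E_lp B wB Bnc wS].
- exact: weakly_amenable_summand wS.
- have D0 := commutative_derivation0 cwA; split; last exact: D0.
  move=> D /D0 {}D0; exists 0 => a; rewrite D0; apply: dual_ext => x.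
  by rewrite adE subrr.
(* An infinite index set supplies the sequence of distinct indices. *)
have [g g_inj] : exists g : nat -> I, injective g.
  have /infiniteP/card_leP[f] := I_inf.
  exists (fun n => val (f (exist _ n (in_setT n)))) => m n /val_inj/inj.
  by move=> /(_ (in_setT _) (in_setT _)) [].
have [x [a xa]] : exists x a : B, bmul x a - bmul a x != 0.
  apply: contra_notP Bnc => nex x a; apply/eqP; rewrite -subr_eq0.
  by apply/negP => /negP xa; apply: nex; exists x, a.
have [phi phi0] := dual_separates xa.
have [psi psiE] := commutator_sum_inner p1 E_lp g_inj phi wS.
have [K HK] := inner_weights_bound p1 E_lp g_inj psiE phi0.
exact: (harmonic_not_le_powR p1 HK).
Qed.
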